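(* Let $d\ge2$ be an integer and $\eta\in[-1,1]$. The two-way assisted quantum capacity of the Holevo-Werner channel $\mathcal{W}_{\eta,d}$ satisfies $$Q_2(\mathcal{W}_{\eta,d})\le E_P^\infty(W_{\eta,d})=\begin{cases}0&\text{if }\eta\ge0,\\ \frac{1+\eta}{2}\log_2(1+\eta)+\frac{1-\eta}{2}\log_2(1-\eta)&\text{if }-\frac2d\le\eta\le0,\\ \log_2\left(\frac{d+2}{d}\right)+\frac{1+\eta}{2}\log_2\left(\frac{d-2}{d+2}\right)&\text{if }\eta\le-\frac2d.\end{cases}$$
   Context: Holevo-Werner channel on $\mathbb{C}^d$: $\mathcal{W}_{\eta,d}(\rho)=\frac{(d-\eta)\mathbf{I}+(d\eta-1)\rho^T}{d^2-1}$ for states $\rho$ ($\mathbf{I}$ the identity operator). Its Choi matrix is the Werner state $W_{\eta,d}=\frac{(d-\eta)\mathbb{I}+(d\eta-1)\mathbb{F}}{d^3-d}$ on $\mathbb{C}^d\otimes\mathbb{C}^d$, with $\mathbb{F}=\sum_{i,j}|ij\rangle\langle ji|$. Convention: $0\log_2 0=0$ (relevant only when $\eta=-1$). Relative entropy: $S(\rho\|\sigma)=\mathrm{Tr}(\rho\log_2\rho-\rho\log_2\sigma)$. $E_P(\rho)=\inf_{\sigma\in\mathrm{PPT}}S(\rho\|\sigma)$, PPT being the states with positive semidefinite partial transpose, and $E_P^\infty(\rho)=\lim_n\frac1nE_P(\rho^{\otimes n})$ (bipartition $A_1\cdots A_n|B_1\cdots B_n$). The displayed closed formula for $E_P^\infty(W_{\eta,d})$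 is a previously known result (Audenaert et al.). Two-way quantum capacity $Q_2(\mathcal{E})$ (equal to the two-way entanglement distribution capacity $D_2(\mathcal{E})$): consider adaptive protocols in which Alice and Bob start from registers prepared by local operations and two-way classical communication (LOCC); in each of $n$ rounds Alice sends one system through $\mathcal{E}$ to Bob, followed by an arbitrary trace-preserving LOCC on all their registers. The final state $\rho^n$ must satisfy $\|\rho^n-\Phi_2^{\otimes nR_n}\|_1\le\varepsilon$ with $\Phi_2$ a two-qubit maximally entangled state. $Q_2(\mathcal{E})$ is the supremum over protocols of $\lim_{n\to\infty}R_n$, as $\varepsilon\to0$. *)

(* Defs.v *)
From HB Require Import structures.
From mathcomp Require Import all_boot all_order all_algebra.
From mathcomp Require Import complex.
From mathcomp Require Import all_classical all_reals all_analysis.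

Set Implicit Arguments.
Unset Strict Implicit.
Unset Printing Implicit Defensive.

Import Order.TTheory GRing.Theory Num.Theory.
Import numFieldNormedType.Exports.

Local Open Scope classical_set_scope.
Local Open Scope complex_scope.
Local Open Scope ring_scope.
Local Open Scope sesquilinear_scope.

(* A finite type T stands for the Hilbert space C^T with its computational   *)
(* basis: T * U is the tensor product, {ffun 'I_n -> T} the n-th tensor      *)
(* power and unit the trivial system.  Operators are matrices acting on      *)
(* column vectors; entry A x y is <x|A|y>.                                   *)
Definition lin (R : realType) (T U : finType) : Type := 'M[R[i]]_(#|U|, #|T|).
Definition op (R : realType) (T : finType) : Type := lin R T T.

Definition entry (R : realType) (T U : finType) (A : lin R T U) (u : U) (t : T) :
  R[i] := A (enum_rank u) (enum_rank t).

Definition mklin (R : realType) (T U : finType) (f : U -> T -> R[i]) :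
  lin R T U := \matrix_(i, j) f (enum_val i) (enum_val j).

Definition tensor (R : realType) (T T' U U' : finType)
  (M : lin R T T') (N : lin R U U') : lin R (T * U)%type (T' * U')%type :=
  mklin (fun x y => entry M x.1 y.1 * entry N x.2 y.2).

Definition psd (R : realType) (n : nat) (A : 'M[R[i]]_n) : Prop :=
  forall v : 'rV[R[i]]_n, 0 <= (v *m A *m v^t*) 0 0.

Definition is_state (R : realType) (T : finType) (rho : op R T) : Prop :=
  psd rho /\ \tr rho = 1.

(* Functional calculus, meaningful for hermitian A. *)
Definition herm_fun (R : realType) (n : nat) (f : R -> R) (A : 'M[R[i]]_n) :
  'M[R[i]]_n :=
  invmx (spectralmx A)
    *m diag_mx (map_mx (fun z => (f (complex.Re z))%:C) (spectral_diag A))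
    *m spectralmx A.

Definition trace_norm (R : realType) (n : nat) (X : 'M[R[i]]_n) : R :=
  complex.Re (\tr (herm_fun Num.sqrt (X^t* *m X))).

(* ln 0 = 0 in the library: this yields 0 log2 0 = 0, and makes the matrix   *)
(* logarithm vanish on the kernel.                                           *)
Definition log2 (R : realType) (x : R) : R := ln x / ln 2.

(* (rho <= sigma)%MS is the inclusion of row spaces; for hermitian matrices  *)
(* it says supp rho is contained in supp sigma.                              *)
Definition rel_entropy (R : realType) (n : nat) (rho sigma : 'M[R[i]]_n) :
  \bar R :=
  if (rho <= sigma)%MS then
    (complex.Re (\tr (rho *m herm_fun (@log2 R) rho
                      - rho *m herm_fun (@log2 R) sigma)))%:E
  else +oo%E.

Definition ptranspose (R : realType) (A B : finType) (X : op R (A * B)%type) :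
  op R (A * B)%type :=
  mklin (fun x y => entry X (x.1, y.2) (y.1, x.2)).

Definition PPT (R : realType) (A B : finType) : set (op R (A * B)%type) :=
  [set sigma | is_state sigma /\ psd (ptranspose sigma)].

Definition EP (R : realType) (A B : finType) (rho : op R (A * B)%type) : \bar R :=
  ereal_inf [set rel_entropy rho sigma | sigma in @PPT R A B].

(* n-th tensor power, with respect to the cut A_1 ... A_n | B_1 ... B_n. *)
Definition bipow (R : realType) (A B : finType) (n : nat)
  (X : op R (A * B)%type) :
  op R ({ffun 'I_n -> A} * {ffun 'I_n -> B})%type :=
  mklin (fun x y : {ffun 'I_n -> A} * {ffun 'I_n -> B} =>
    \prod_(i < n) entry X (x.1 i, x.2 i) (y.1 i, y.2 i)).

Definition EP_rate (R : realType) (A B : finType) (rho : op R (A * B)%type)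
  (n : nat) : \bar R := ((n%:R^-1)%:E * EP (bipow n rho))%E.

Definition EP_inf (R : realType) (A B : finType) (rho : op R (A * B)%type) :
  \bar R := lim (EP_rate rho n @[n --> \oo]).

(* Trace-preserving LOCC with finitely many rounds.  In each round one party *)
(* performs a local instrument, given by Kraus operators M k from its        *)
(* register to a possibly new one, and broadcasts the outcome k; everything  *)
(* that follows may depend on k.                                             *)
Inductive LOCC (R : realType) : forall A B A' B' : finType,
  (op R (A * B)%type -> op R (A' * B')%type) -> Prop :=
| LOCC_id (A B : finType) : @LOCC R A B A B id
| LOCC_alice (A B A' B' K : finType) (Ak : K -> finType)
    (M : forall k, lin R A (Ak k))
    (F : forall k, op R (Ak k * B)%type -> op R (A' * B')%type) :
    \sum_k (M k)^t* *m M k = 1%:M ->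
    (forall k, LOCC (F k)) ->
    @LOCC R A B A' B' (fun X =>
      \sum_k F k (tensor (M k) (1%:M : op R B) *m X
                    *m (tensor (M k) (1%:M : op R B))^t*))
| LOCC_bob (A B A' B' K : finType) (Bk : K -> finType)
    (M : forall k, lin R B (Bk k))
    (F : forall k, op R (A * Bk k)%type -> op R (A' * B')%type) :
    \sum_k (M k)^t* *m M k = 1%:M ->
    (forall k, LOCC (F k)) ->
    @LOCC R A B A' B' (fun X =>
      \sum_k F k (tensor (1%:M : op R A) (M k) *m X
                    *m (tensor (1%:M : op R A) (M k))^t*)).

(* The linear map E applied to Alice's system S, whose output is handed to   *)
(* Bob, and the identity on the registers A and B.                           *)
Definition transmit (R : realType) (S T A B : finType)
  (E : op R S -> op R T) (X : op R ((A * S) * B)%type) :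
  op R (A * (T * B))%type :=
  mklin (fun x y =>
    entry (E (mklin (fun s s' =>
      entry X ((x.1, s), x.2.2) ((y.1, s'), y.2.2)))) x.2.1 y.2.1).

(* adaptive E n rho: rho is the state of the registers A, B at the end of an *)
(* adaptive protocol with n uses of E.                                       *)
Inductive adaptive (R : realType) (S T : finType) (E : op R S -> op R T) :
  nat -> forall A B : finType, op R (A * B)%type -> Prop :=
| adaptive_init (A B : finType)
    (L : op R (unit * unit)%type -> op R (A * B)%type) :
    LOCC L -> @adaptive R S T E 0 A B (L 1%:M)
| adaptive_round (n : nat) (A B A' B' : finType)
    (rho : op R ((A * S) * B)%type)
    (L : op R (A * (T * B))%type -> op R (A' * B')%type) :
    @adaptive R S T E n (A * S)%type B rho -> LOCC L ->
    @adaptive R S T E n.+1 A' B' (L (transmit E rho)).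

Definition ebit (R : realType) : op R ('I_2 * 'I_2)%type :=
  mklin (fun x y => if (x.1 == x.2) && (y.1 == y.2) then 2^-1 else 0).

(* n uses of E distribute m = n R_n ebits up to error eps. *)
Definition distributes (R : realType) (S T : finType) (E : op R S -> op R T)
  (n m : nat) (eps : R) : Prop :=
  exists rho : op R ({ffun 'I_m -> 'I_2} * {ffun 'I_m -> 'I_2})%type,
    adaptive E n rho /\ trace_norm (rho - bipow m (ebit R)) <= eps.

Definition Q2_eps (R : realType) (S T : finType) (E : op R S -> op R T)
  (eps : R) : \bar R :=
  ereal_sup [set r%:E | r in [set r : R | exists m : nat -> nat,
    (forall n, (0 < n)%N -> distributes E n (m n) eps) /\
    (m n)%:R / n%:R @[n --> \oo] --> r]].

Definition Q2 (R : realType) (S T : finType) (E : op R S -> op R T) : \bar R :=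
  lim (Q2_eps E eps @[eps --> (0 : R)^'+]).

(* Extended linearly from states, hence the factor \tr rho. *)
Definition HW_channel (R : realType) (d : nat) (eta : R) (rho : op R 'I_d) :
  op R 'I_d :=
  (d%:R ^+ 2 - 1)^-1 *:
    (((d%:R - eta%:C) * \tr rho)%:M + (d%:R * eta%:C - 1) *: rho^T).

Definition flip (R : realType) (d : nat) : op R ('I_d * 'I_d)%type :=
  mklin (fun x y => ((x.1 == y.2) && (x.2 == y.1))%:R).

Definition werner (R : realType) (d : nat) (eta : R) :
  op R ('I_d * 'I_d)%type :=
  (d%:R ^+ 3 - d%:R)^-1 *:
    ((d%:R - eta%:C)%:M + (d%:R * eta%:C - 1) *: flip R d).

(* Main.v *)
Require Import Defs.
From HB Require Import structures.
From mathcomp Require Import all_boot all_order all_algebra.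
From mathcomp Require Import complex.
From mathcomp Require Import all_classical all_reals all_analysis.
From mathcomp Require Import ring lra.

Set Implicit Arguments.
Unset Strict Implicit.
Unset Printing Implicit Defensive.

Import Order.TTheory GRing.Theory Num.Theory.
Import numFieldNormedType.Exports.

Local Open Scope classical_set_scope.
Local Open Scope ring_scope.

(* Put p = (1 + eta)/2, q = (1 - eta)/2 and let g be eta clipped to [-2/d, 0].
   The channel is the mixture p E_+ + q E_- of the symmetric and antisymmetric
   Werner channels; with a = p/(1+g) and b = q/(1-g), the operator
   X = a W_+ + b W_- has partial transpose of trace norm at most 1, and the
   value of the bound is f = p log2 (1+g) + q log2 (1-g).

   Lower bound on E_P: with G = 1 + g F, the inequality ln x <= x - 1 gives
   S(W^n || sigma) >= n f + (1 - Tr sigma G^n)/ln 2, and G^Gamma has spectrum in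
   [-1, 1], so that Tr sigma G^n = Tr sigma^Gamma (G^Gamma)^n <= 1 for sigma PPT.

   Upper bound on E_P: |X^Gamma| is dominated by omega^Gamma for a PPT Werner
   state omega; then omega^n + X^n is PPT up to a normalisation in [1, 2],
   whence E_P(W^n) <= n f + 1.

   Upper bound on Q_2: expand an adaptive protocol over the strings
   s in {+,-}^n telling which of E_+, E_- acted, rho = sum_s p(s) rho_s.  The
   operator sum_s a(s) rho_s, where a(s) is the product of the weights a, b,
   inherits the bound on the partial transpose, because partial transposition
   conjugates LOCC maps into LOCC maps; its overlap with m ebits is at most 2^-m.
   Since log2 (p(s)/a(s)) concentrates around n f by Chebyshev's inequality,
   m cannot exceed n (f + o(1)). *)

(** * Matrices in a fixed orthonormal basis *)

Section GenericMatrices.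
Local Open Scope sesquilinear_scope.
Variable C : numClosedFieldType.

Lemma adjM m n p (A : 'M[C]_(m, n)) (B : 'M[C]_(n, p)) :
  (A *m B)^t* = B^t* *m A^t*.
Proof. by rewrite trmx_mul map_mxM. Qed.

Lemma adjD m n (A B : 'M[C]_(m, n)) : (A + B)^t* = A^t* + B^t*.
Proof. by rewrite linearD map_mxD. Qed.

Lemma adjZ m n c (A : 'M[C]_(m, n)) : (c *: A)^t* = c^* *: A^t*.
Proof. by rewrite linearZ map_mxZ. Qed.

(** The predicate [psd] over an arbitrary [numClosedFieldType]; at [R[i]] the two are convertible,
    so the results below transfer by [exact:]. *)
Definition gpsd n (A : 'M[C]_n) : Prop :=
  forall v : 'rV[C]_n, 0 <= (v *m A *m v^t*) 0 0.

Section PSD.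
Variable n : nat.
Implicit Types A B : 'M[C]_n.

Lemma gpsdD A B : gpsd A -> gpsd B -> gpsd (A + B).
Proof.
by move=> a b v; rewrite mulmxDr mulmxDl mxE addr_ge0.
Qed.

Lemma gpsd0 : gpsd (0 : 'M[C]_n).
Proof. by move=> v; rewrite mulmx0 mul0mx mxE. Qed.

Lemma gpsd_sum (I : Type) (r : seq I) (F : I -> 'M[C]_n) :
  (forall i, gpsd (F i)) -> gpsd (\sum_(i <- r) F i).
Proof.
by move=> FP; apply: big_ind => //; [exact: gpsd0|exact: gpsdD].
Qed.

Lemma gpsdZ c A : 0 <= c -> gpsd A -> gpsd (c *: A).
Proof. by move=> c0 a v; rewrite -scalemxAr -scalemxAl mxE mulr_ge0. Qed.

Lemma gpsd_conj m (K : 'M[C]_(m, n)) A : gpsd A -> gpsd (K *m A *m K^t*).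
Proof.
by move=> a v; have := a (v *m K); rewrite adjM !mulmxA.
Qed.

Lemma gpsd_diag_ge0 A i : gpsd A -> 0 <= A i i.
Proof.
move=> a; have := a (delta_mx 0 i); rewrite -rowE.
suff -> : (row i A *m (delta_mx (0 : 'I_1) i)^t*) 0 0 = A i i by [].
rewrite mxE (bigD1 i) //= big1 ?addr0; last first.
  by move=> j ji; rewrite !mxE eqxx (negbTE ji) /= conjC0 mulr0.
by rewrite !mxE !eqxx conjC1 mulr1.
Qed.

Lemma gpsd_tr_ge0 A : gpsd A -> 0 <= \tr A.
Proof. by move=> a; apply: sumr_ge0 => i _; exact: gpsd_diag_ge0. Qed.

(** Polarisation: positivity of the form at [x *: e_i + e_j] with [x = 1] and [x = 'i] makes
    [A i j + A j i] and ['i * (A i j - A j i)] real, and these two facts determine the conjugate of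
    [A j i]. *)
Lemma gpsd_herm A : gpsd A -> A^t* = A.
Proof.
move=> a.
have q (x : C) i j : (x *: delta_mx 0 i + delta_mx 0 j : 'rV[C]_n) *m A *m
   (x *: delta_mx 0 i + delta_mx 0 j : 'rV[C]_n)^t* =
   (x * x^* * A i i + x * A i j + x^* * A j i + A j j)%:M.
  have h k l : (delta_mx 0 k : 'rV[C]_n) *m A *m (delta_mx 0 l : 'rV[C]_n)^t*
      = (A k l)%:M.
    apply/matrixP => s t; rewrite !ord1 -rowE mxE (bigD1 l) //= big1 ?addr0.
      by rewrite !mxE !eqxx conjC1 mulr1.
    by move=> u ul; rewrite !mxE eqxx (negbTE ul) /= conjC0 mulr0.
  rewrite adjD adjZ !mulmxDl !mulmxDr -!scalemxAl -!scalemxAr !h.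
  by rewrite !scale_scalar_mx -!raddfD; congr (_%:M); ring.
have Q x i j : 0 <= x * x^* * A i i + x * A i j + x^* * A j i + A j j.
  by have := a (x *: delta_mx 0 i + delta_mx 0 j); rewrite q mxE eqxx.
apply/matrixP => i j; rewrite !mxE.
have dg k : (A k k) \is Num.real by exact/ger0_real/gpsd_diag_ge0.
have r1 : (A i j + A j i) \is Num.real.
  have := ger0_real (Q 1 i j); rewrite conjC1 !mul1r.
  move=> h; rewrite -(_ : A i i + A i j + A j i + A j j - A i i - A j j =
    A i j + A j i); last by ring.
  by rewrite !rpredB.
have r2 : ('i * (A i j - A j i)) \is Num.real.
  have := ger0_real (Q 'i i j); rewrite conjCi mulrN -expr2 sqrCi opprK mul1r.
  move=> h; rewrite -(_ : A i i + 'i * A i j + - 'i * A j i + A j j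
    - A i i - A j j = 'i * (A i j - A j i)); last by ring.
  by rewrite !rpredB.
move/CrealP: r1; rewrite rmorphD => r1.
move/CrealP: r2; rewrite rmorphM rmorphB /= conjCi => r2.
have r3 : (A i j)^* - (A j i)^* = - (A i j - A j i).
  apply: (mulfI (neq0Ci C)); rewrite mulrN -r2; ring.
apply: (mulfI (_ : 2 != 0 :> C)); first by rewrite pnatr_eq0.
have -> : 2 * (A j i)^* = ((A i j)^* + (A j i)^*) - ((A i j)^* - (A j i)^*).
  by ring.
by rewrite r1 r3; ring.
Qed.
End PSD.


(** For unitary [U], the operator with eigenvalues [e i] and eigenvectors the adjoints of the rows
    of [U]. Eigenvalues form a function, so that the calculus on a fixed basis is pointwise. *)
Definition gdiag n (U : 'M[C]_n) (e : 'I_n -> C) : 'M[C]_n :=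
  U^t* *m diag_mx (\row_i e i) *m U.

Section Gdiag.
Variables (n : nat) (U : 'M[C]_n).
Implicit Types e f : 'I_n -> C.

Lemma gdiag_map (f : C -> C) (D : 'rV[C]_n) :
  gdiag U (fun i => f (D 0 i)) = U^t* *m diag_mx (map_mx f D) *m U.
Proof. by congr (_ *m diag_mx _ *m _); apply/rowP => i; rewrite !mxE. Qed.

Lemma gdiagD e f : gdiag U (fun i => e i + f i) = gdiag U e + gdiag U f.
Proof.
rewrite /gdiag -mulmxDl -mulmxDr; congr (_ *m _ *m _).
by apply/matrixP => i j; rewrite !mxE mulrnDl.
Qed.

Lemma gdiagZ c e : gdiag U (fun i => c * e i) = c *: gdiag U e.
Proof.
rewrite /gdiag scalemxAl scalemxAr; congr (_ *m _ *m _).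
by apply/matrixP => i j; rewrite !mxE mulrnAr.
Qed.

Lemma gdiag_adj e : (forall i, (e i)^* = e i) -> (gdiag U e)^t* = gdiag U e.
Proof.
move=> er; rewrite /gdiag !adjM trmxCK mulmxA; congr (_ *m _ *m _).
apply/matrixP => i j; rewrite !mxE rmorphMn /= er eq_sym.
by case: eqVneq => // ->.
Qed.

Lemma gpsd_gdiag e : (forall i, 0 <= e i) -> gpsd (gdiag U e).
Proof.
move=> e0; rewrite /gdiag -{2}(trmxCK U); apply: gpsd_conj => v.
rewrite mxE sumr_ge0 // => i _; rewrite mul_mx_diag !mxE.
by rewrite mulrAC mulr_ge0 ?mul_conjC_ge0.
Qed.

Lemma tr_gdiagM e (B : 'M[C]_n) :
  \tr (gdiag U e *m B) = \sum_i e i * (U *m B *m U^t*) i i.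
Proof.
rewrite /gdiag -!mulmxA mxtrace_mulC -!mulmxA (mulmxA U) mul_diag_mx.
by rewrite /mxtrace; apply: eq_bigr => i _; rewrite !mxE.
Qed.

Lemma gpsd_tr_gdiagM e (B : 'M[C]_n) :
  (forall i, 0 <= e i) -> gpsd B -> 0 <= \tr (gdiag U e *m B).
Proof.
move=> e0 b; rewrite tr_gdiagM sumr_ge0 // => i _.
by rewrite mulr_ge0 //; exact/gpsd_diag_ge0/gpsd_conj.
Qed.

Hypothesis UU : U \is unitarymx.

Lemma unitary_adjK : U^t* *m U = 1%:M.
Proof. exact/mulmx1C/unitarymxP. Qed.

Lemma tr_gdiag e : \tr (gdiag U e) = \sum_i e i.
Proof.
rewrite -[gdiag U e]mulmx1 tr_gdiagM mulmx1 (unitarymxP UU).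
by apply: eq_bigr => i _; rewrite mxE eqxx mulr1.
Qed.

Lemma gdiagM e f : gdiag U e *m gdiag U f = gdiag U (fun i => e i * f i).
Proof.
rewrite /gdiag !mulmxA mulmxtVK // -(mulmxA (U^t*)) mulmx_diag.
by congr (_ *m diag_mx _ *m _); apply/rowP => i; rewrite !mxE.
Qed.

Lemma gdiag_cst c : gdiag U (fun=> c) = c%:M.
Proof.
have -> : gdiag U (fun=> c) = c *: (U^t* *m U).
  rewrite /gdiag scalemxAl; congr (_ *m _).
  rewrite -mul_mx_scalar; congr (_ *m _).
  by apply/matrixP => i j; rewrite !mxE.
by rewrite unitary_adjK scalemx1.
Qed.

Lemma gdiag_inj e f : gdiag U e = gdiag U f -> e =1 f.
Proof.
have k g : U *m gdiag U g *m U^t* = diag_mx (\row_i g i).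
  by rewrite /gdiag !mulmxA (unitarymxP UU) mul1mx mulmxtVK.
move=> ef i.
have : U *m gdiag U e *m U^t* = U *m gdiag U f *m U^t* by rewrite ef.
by rewrite !k => /matrixP/(_ i i); rewrite !mxE eqxx !mulr1n.
Qed.

End Gdiag.

Lemma herm_gdiag n (A : 'M[C]_n) : A^t* = A ->
  A = gdiag (spectralmx A) (fun i => spectral_diag A 0 i) /\
  forall i, spectral_diag A 0 i \is Num.real.
Proof.
move=> hA; have hs : A \is hermsymmx.
  by apply/is_hermitianmxP; rewrite expr0 scale1r hA.
split; last first.
  by move=> i; have /mxOverP := hermitian_spectral_diag_real hs; apply.
have /orthomx_spectralP {1}-> := hermitian_normalmx hs.
rewrite invmx_unitary ?spectral_unitarymx //; congr (_ *m diag_mx _ *m _).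
by apply/rowP => i; rewrite !mxE.
Qed.

(** The change of basis [W] intertwines the two diagonal matrices, so [W i j] can be nonzero only
    where the eigenvalues agree. There [f] and [g] agree as well, and [W] intertwines them too. *)
Lemma gdiag_fun_unique n (U V : 'M[C]_n) e l f g :
  U \is unitarymx -> V \is unitarymx ->
  (forall i j, e i = l j -> f i = g j) ->
  gdiag U e = gdiag V l -> gdiag U f = gdiag V g.
Proof.
move=> UU VV efg AE; set W := V *m U^t*.
have We : W *m diag_mx (\row_i e i) = diag_mx (\row_i l i) *m W.
  have : V *m gdiag V l *m U^t* = V *m gdiag U e *m U^t* by rewrite AE.
  rewrite /gdiag !mulmxA (unitarymxP VV) mul1mx mulmxtVK //.
have Wf : W *m diag_mx (\row_i f i) = diag_mx (\row_i g i) *m W.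
  move: {AE} W We => W; rewrite !mul_mx_diag !mul_diag_mx => /matrixP We.
  apply/matrixP => i j; move: (We i j); rewrite !mxE mulrC.
  have [->|w0] := eqVneq (W i j) 0; first by rewrite mul0r !mulr0.
  by rewrite [W i j * _]mulrC => /(mulIf w0) /efg ->; rewrite mulrC.
have -> : gdiag V g = V^t* *m (diag_mx (\row_i g i) *m W) *m U.
  by rewrite /W /gdiag !mulmxA -!(mulmxA _ (U^t*)) unitary_adjK // mulmx1.
by rewrite -Wf /W /gdiag !mulmxA unitary_adjK // mul1mx.
Qed.

End GenericMatrices.

(** * Operators indexed by finite types and real functional calculus *)

Section Matrices.
Local Open Scope sesquilinear_scope.
Variable R : realType.
Local Notation C := R[i].
Local Notation "x %:C" := (real_complex R x) : ring_scope.

Lemma mklinK (T U : finType) (f : U -> T -> C) u t :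
  entry (mklin f) u t = f u t.
Proof. by rewrite /entry mxE !enum_rankK. Qed.

Lemma entryP (T U : finType) (A B : lin R T U) :
  (forall u t, entry A u t = entry B u t) -> A = B.
Proof.
move=> AB; apply/matrixP => i j.
by have := AB (enum_val i) (enum_val j); rewrite /entry !enum_valK.
Qed.

Lemma sum_enum_rank (V : nmodType) (T : finType) (F : 'I_#|T| -> V) :
  \sum_i F i = \sum_(t : T) F (enum_rank t).
Proof.
by rewrite (reindex enum_rank) //; apply/onW_bij/enum_rank_bij.
Qed.

Lemma entryM (T U V : finType) (A : lin R U V) (B : lin R T U) v t :
  entry (A *m B : lin R T V) v t = \sum_u entry A v u * entry B u t.
Proof. by rewrite /entry mxE sum_enum_rank. Qed.

Lemma entryD (T U : finType) (A B : lin R T U) u t :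
  entry (A + B : lin R T U) u t = entry A u t + entry B u t.
Proof. by rewrite /entry mxE. Qed.

Lemma entryZ (T U : finType) c (A : lin R T U) u t :
  entry (c *: A : lin R T U) u t = c * entry A u t.
Proof. by rewrite /entry mxE. Qed.

Lemma entry_sum (T U I : finType) (F : I -> lin R T U) u t :
  entry (\sum_i F i : lin R T U) u t = \sum_i entry (F i) u t.
Proof. by rewrite /entry summxE. Qed.

Lemma entry_tr (T : finType) (A : op R T) u t :
  entry (A^T : op R T) u t = entry A t u.
Proof. by rewrite /entry mxE. Qed.

Lemma entry_trC (T U : finType) (A : lin R T U) u t :
  entry (A^t* : lin R U T) t u = (entry A u t)^*.
Proof. by rewrite /entry !mxE. Qed.

Lemma entry_scalar (T : finType) (c : C) u t :
  entry (c%:M : op R T) u t = c *+ (u == t).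
Proof. by rewrite /entry mxE (inj_eq enum_rank_inj). Qed.

Lemma trace_entry (T : finType) (A : op R T) : \tr A = \sum_t entry A t t.
Proof. by rewrite /mxtrace sum_enum_rank. Qed.

Lemma conjC_real (x : R) : (x%:C : C)^* = x%:C.
Proof. exact: conjc_real. Qed.

Lemma Re_sum (I : Type) (r : seq I) (P : pred I) (F : I -> C) :
  complex.Re (\sum_(i <- r | P i) F i) = \sum_(i <- r | P i) complex.Re (F i).
Proof. by elim/big_rec2: _ => [|i y z _ <-] //; case: (F i) z => ? ? []. Qed.

Lemma ReM_real (x : R) (z : C) : complex.Re (x%:C * z) = x * complex.Re z.
Proof. by case: z => a b /=; rewrite mul0r subr0. Qed.

Lemma ReD (x y : C) : complex.Re (x + y) = complex.Re x + complex.Re y.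
Proof. by case: x y => ? ? []. Qed.

Lemma ReN (x : C) : complex.Re (- x) = - complex.Re x.
Proof. by case: x. Qed.

Lemma Re_le (x y : C) : x <= y -> complex.Re x <= complex.Re y.
Proof. by rewrite lecE => /andP[]. Qed.


Section PSD.
Variable n : nat.
Implicit Types A B : 'M[C]_n.

Lemma psdD A B : psd A -> psd B -> psd (A + B).
Proof. exact: gpsdD. Qed.

Lemma psd0 : psd (0 : 'M[C]_n).
Proof. exact: gpsd0. Qed.

Lemma psd_sum (I : Type) (r : seq I) (F : I -> 'M[C]_n) :
  (forall i, psd (F i)) -> psd (\sum_(i <- r) F i).
Proof. exact: gpsd_sum. Qed.

Lemma psdZ (c : R) A : 0 <= c -> psd A -> psd (c%:C *: A).
Proof. by move=> c0; apply: gpsdZ; rewrite ler0c. Qed.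

Lemma psd_conj m (K : 'M[C]_(m, n)) A : psd A -> psd (K *m A *m K^t*).
Proof. exact: gpsd_conj. Qed.

Lemma psd_diag_ge0 A i : psd A -> 0 <= A i i.
Proof. exact: gpsd_diag_ge0. Qed.

Lemma psd_tr_ge0 A : psd A -> 0 <= \tr A.
Proof. exact: gpsd_tr_ge0. Qed.

Lemma psd_herm A : psd A -> A^t* = A.
Proof. exact: gpsd_herm. Qed.
End PSD.

Definition udiag n (U : 'M[C]_n) (e : 'I_n -> R) : 'M[C]_n :=
  gdiag U (fun i => (e i)%:C).

Section Udiag.
Variables (n : nat) (U : 'M[C]_n).
Implicit Types e f : 'I_n -> R.

Lemma eq_udiag e f : e =1 f -> udiag U e = udiag U f.
Proof. by move=> /funext ->. Qed.

Lemma udiagD e f : udiag U (fun i => e i + f i) = udiag U e + udiag U f.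
Proof.
rewrite /udiag -gdiagD; congr gdiag.
by apply/funext => i; rewrite rmorphD.
Qed.

Lemma udiagZ c e : udiag U (fun i => c * e i) = c%:C *: udiag U e.
Proof.
rewrite /udiag -gdiagZ; congr gdiag.
by apply/funext => i; rewrite rmorphM.
Qed.

Lemma udiag_adj e : (udiag U e)^t* = udiag U e.
Proof. by apply: gdiag_adj => i; exact: conjC_real. Qed.

Lemma psd_udiag e : (forall i, 0 <= e i) -> psd (udiag U e).
Proof. by move=> e0; apply: gpsd_gdiag => i; rewrite ler0c. Qed.

Lemma tr_udiagM e (B : 'M[C]_n) :
  \tr (udiag U e *m B) = \sum_i (e i)%:C * (U *m B *m U^t*) i i.
Proof. exact: tr_gdiagM. Qed.

Lemma psd_tr_udiagM e (B : 'M[C]_n) :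
  (forall i, 0 <= e i) -> psd B -> 0 <= \tr (udiag U e *m B).
Proof. by move=> e0; apply: gpsd_tr_gdiagM => i; rewrite ler0c. Qed.

Hypothesis UU : U \is unitarymx.

Lemma tr_udiag e : \tr (udiag U e) = (\sum_i e i)%:C.
Proof. by rewrite /udiag (tr_gdiag UU) rmorph_sum. Qed.

Lemma udiagM e f : udiag U e *m udiag U f = udiag U (fun i => e i * f i).
Proof.
rewrite /udiag (gdiagM UU); congr gdiag.
by apply/funext => i; rewrite rmorphM.
Qed.

Lemma udiag_cst c : udiag U (fun=> c) = (c%:C)%:M.
Proof. exact: gdiag_cst. Qed.

Lemma udiag_inj e f : udiag U e = udiag U f -> e =1 f.
Proof. by move=> /(gdiag_inj UU) ef i; have /complexI := ef i. Qed.

End Udiag.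

Lemma herm_udiag n (A : 'M[C]_n) : A^t* = A ->
  A = udiag (spectralmx A) (fun i => complex.Re (spectral_diag A 0 i)).
Proof.
move=> /herm_gdiag[AE lr]; rewrite [LHS]AE; congr gdiag.
by apply/funext => i; rewrite RRe_real.
Qed.

(** [herm_fun] is defined through the basis [spectralmx A]; by uniqueness of the functional calculus
    it may be computed in any orthonormal eigenbasis. *)
Lemma herm_fun_udiag n (U : 'M[C]_n) e f : U \is unitarymx ->
  herm_fun f (udiag U e) = udiag U (f \o e).
Proof.
move=> UU; set A := udiag U e.
have hA : A^t* = A by exact: udiag_adj.
rewrite /herm_fun (invmx_unitary (spectral_unitarymx A)).
rewrite -gdiag_map.
apply/esym; apply: (gdiag_fun_unique UU (spectral_unitarymx A) _
  (herm_udiag hA)) => i j /complexI.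
by move=> /= ->.
Qed.

End Matrices.

(** * Partial transposition and tensor powers *)

Section Bipartite.
Local Open Scope sesquilinear_scope.
Variable R : realType.
Local Notation C := R[i].
Local Notation "x %:C" := (real_complex R x) : ring_scope.

Section PartialTranspose.
Variables A B : finType.
Implicit Types X Y : op R (A * B)%type.

Lemma entry_ptranspose X x y :
  entry (ptranspose X) x y = entry X (x.1, y.2) (y.1, x.2).
Proof. by rewrite mklinK. Qed.

Lemma ptransposeK : involutive (@ptranspose R A B).
Proof. by move=> X; apply: entryP => -[? ?] [? ?]; rewrite !entry_ptranspose. Qed.

Lemma ptransposeD X Y : ptranspose (X + Y) = ptranspose X + ptranspose Y.
Proof.
by apply: entryP => x y; rewrite entry_ptranspose !entryD !entry_ptranspose.
Qed.

Lemma ptransposeZ c X : ptranspose (c *: X) = c *: ptranspose X.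
Proof.
by apply: entryP => x y; rewrite entry_ptranspose !entryZ !entry_ptranspose.
Qed.

Lemma ptransposeN X : ptranspose (- X) = - ptranspose X.
Proof. by rewrite -scaleN1r ptransposeZ scaleN1r. Qed.

Lemma ptranspose_sum (I : finType) (F : I -> op R (A * B)%type) :
  ptranspose (\sum_i F i) = \sum_i ptranspose (F i).
Proof.
apply: entryP => x y; rewrite entry_ptranspose !entry_sum.
by apply: eq_bigr => i _; rewrite entry_ptranspose.
Qed.

Lemma ptranspose_scalar c : ptranspose (c%:M : op R (A * B)%type) = c%:M.
Proof.
apply: entryP => -[a b] [a' b'].
rewrite entry_ptranspose !entry_scalar !xpair_eqE /= [b' == b]eq_sym //.
Qed.

Lemma tr_ptranspose X : \tr (ptranspose X) = \tr X.
Proof.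
rewrite !trace_entry; apply: eq_bigr => -[a b] _; exact: entry_ptranspose.
Qed.

Lemma trace_entryM (T : finType) (X Y : op R T) :
  \tr (X *m Y) = \sum_(p : T * T) entry X p.1 p.2 * entry Y p.2 p.1.
Proof.
rewrite trace_entry -(pair_bigA _ (fun x y => entry X x y * entry Y y x)) /=.
by apply: eq_bigr => x _; rewrite (entryM X Y).
Qed.

(** The trace is a sum over pairs of indices, and the involution [h], which exchanges the Bob
    components of row and column, permutes its terms. This duality moves every overlap to the
    partially transposed side. *)
Lemma tr_ptransposeM X Y :
  \tr (ptranspose X *m ptranspose Y) = \tr (X *m Y).
Proof.
rewrite !trace_entryM.
pose h (p : (A * B) * (A * B)) := ((p.1.1, p.2.2), (p.2.1, p.1.2)).
have hK : involutive h by move=> [[? ?] [? ?]].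
rewrite (reindex h) /=; last by apply: onW_bij; exact: inv_bij.
by apply: eq_bigr => -[[? ?] [? ?]] _; rewrite !entry_ptranspose.
Qed.

End PartialTranspose.

Section TensorPower.
Variables (A B : finType) (n : nat).
Local Notation AB := ({ffun 'I_n -> A} * {ffun 'I_n -> B})%type.
Implicit Types X Y U : op R (A * B)%type.

(** Distributivity of products over sums, once a pair of strings is identified with a string of
    pairs. It serves both for matrix products and for sums over product spectra. *)
Lemma sum_prod_pair (K : comPzSemiRingType) (F : 'I_n -> A * B -> K) :
  \sum_(z : AB) \prod_i F i (z.1 i, z.2 i) = \prod_i \sum_t F i t.
Proof.
rewrite bigA_distr_bigA /=.
pose h (f : {ffun 'I_n -> A * B}) : AB :=
  ([ffun i => (f i).1], [ffun i => (f i).2]).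
pose k (z : AB) := [ffun i => (z.1 i, z.2 i)].
have hk : cancel h k by move=> f; apply/ffunP => i; rewrite !ffunE -surjective_pairing.
have kh : cancel k h.
  by move=> [u v]; congr (_, _); apply/ffunP => i; rewrite !ffunE.
rewrite (reindex h) /=; last by apply: onW_bij; exists k.
apply: eq_bigr => f _; apply: eq_bigr => i _.
by rewrite !ffunE -surjective_pairing.
Qed.

Lemma entry_bipow X x y :
  entry (bipow n X) x y = \prod_i entry X (x.1 i, x.2 i) (y.1 i, y.2 i).
Proof. by rewrite mklinK. Qed.

Lemma bipowM X Y : bipow n (X *m Y) = bipow n X *m bipow n Y.
Proof.
apply: entryP => x y; rewrite entry_bipow (entryM (bipow n X) (bipow n Y)).
under eq_bigr do rewrite entryM.
under [RHS]eq_bigr do rewrite !entry_bipow -big_split.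
exact/esym/(sum_prod_pair (fun i t => entry X (x.1 i, x.2 i) t *
  entry Y t (y.1 i, y.2 i))).
Qed.

Lemma bipow_adj X : bipow n (X^t*) = (bipow n X)^t*.
Proof.
apply: entryP => x y; rewrite entry_bipow (entry_trC (bipow n X)) entry_bipow.
by rewrite rmorph_prod; apply: eq_bigr => i _; rewrite entry_trC.
Qed.

Lemma bipow_diag (c : A * B -> C) :
  bipow n (diag_mx (\row_i c (enum_val i))) =
  diag_mx (\row_(k < #|{: AB}|)
    \prod_i c ((enum_val k : AB).1 i, (enum_val k : AB).2 i)).
Proof.
apply: entryP => x y; rewrite entry_bipow.
have E (T : finType) (f : T -> C) s t :
    entry (diag_mx (\row_i f (enum_val i)) : op R T) s t = f s *+ (s == t).
  by rewrite /entry !mxE enum_rankK (inj_eq enum_rank_inj).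
rewrite (E _ (fun z : AB => \prod_i c (z.1 i, z.2 i))).
have [<-|xy] := eqVneq x y.
  by apply: eq_bigr => i _; rewrite E eqxx.
have [i xyi] : exists i, (x.1 i, x.2 i) != (y.1 i, y.2 i).
  apply/existsP; apply: contraNT xy; rewrite negb_exists => /forallP h.
  case: x y h => [x1 x2] [y1 y2] h.
  by apply/eqP; congr (_, _); apply/ffunP => i;
    have := h i; rewrite negbK => /eqP[].
by rewrite (bigD1 i) //= E (negbTE xyi) mul0r.
Qed.

Lemma bipow_scalar c : bipow n (c%:M : op R (A * B)%type) = (c ^+ n)%:M.
Proof.
have sc (T : finType) z : z%:M = diag_mx (\row_i z) :> op R T.
  by apply/matrixP => i j; rewrite !mxE.
rewrite !sc (bipow_diag (fun=> c)); congr diag_mx; apply/rowP => i.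
by rewrite !mxE prodr_const card_ord.
Qed.

Lemma ptranspose_bipow X : ptranspose (bipow n X) = bipow n (ptranspose X).
Proof.
apply: entryP => x y; rewrite entry_ptranspose !entry_bipow.
by apply: eq_bigr => i _; rewrite entry_ptranspose.
Qed.

Lemma bipow_unitary U : U \is unitarymx -> bipow n U \is unitarymx.
Proof.
move=> /unitarymxP UU; apply/unitarymxP.
by rewrite -bipow_adj -bipowM UU (bipow_scalar 1) expr1n.
Qed.

End TensorPower.

(** Eigenvalues are labelled by [T] itself rather than by ordinals, so that those of a tensor power
    are products along strings. *)
Definition opdiag (T : finType) (U : op R T) (e : T -> R) : op R T :=
  udiag U (fun i => e (enum_val i)).

Lemma bipow_opdiag (A B : finType) n (U : op R (A * B)%type) e :
  bipow n (opdiag U e) =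
  opdiag (bipow n U) (fun z => \prod_i e (z.1 i, z.2 i)).
Proof.
rewrite /opdiag /udiag /gdiag !bipowM bipow_adj.
rewrite (bipow_diag n (fun x => (e x)%:C)).
set D := \row_k _; set D' := \row_k _; suff -> : D = D' by [].
by apply/rowP => i; rewrite !mxE rmorph_prod.
Qed.

Lemma sum_enum_val (T : finType) (e : T -> R) :
  \sum_(i < #|T|) e (enum_val i) = \sum_t e t.
Proof. by rewrite sum_enum_rank; apply: eq_bigr => t _; rewrite enum_rankK. Qed.

End Bipartite.

(** * Werner channels *)

Section KrausMaps.
Local Open Scope sesquilinear_scope.
Variables (C : numClosedFieldType) (n : nat).
Implicit Type X : 'M[C]_n.

Lemma delta_mulmx_delta X i j k l :
  (delta_mx i j : 'M[C]_n) *m X *m (delta_mx k l : 'M[C]_n) = X j k *: delta_mx i l.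
Proof.
apply/matrixP => s t; rewrite !mxE (bigD1 k) //= big1 ?addr0; last first.
  by move=> u uk; rewrite [delta_mx k l u t]mxE (negbTE uk) /= mulr0.
rewrite [delta_mx k l k t]mxE eqxx /= mxE (bigD1 j) //= big1 ?addr0; last first.
  by move=> u uj; rewrite mxE (negbTE uj) andbF mul0r.
rewrite !mxE eqxx andbT.
by case: (s == i); case: (t == l); rewrite /= ?(mulr1, mulr0, mul1r, mul0r).
Qed.

Lemma delta_mx_adj i j : (delta_mx i j : 'M[C]_n)^t* = delta_mx j i.
Proof. by apply/matrixP => s t; rewrite !mxE rmorph_nat andbC. Qed.

Lemma sum_delta_diag : \sum_i delta_mx i i = 1%:M :> 'M[C]_n.
Proof.
apply/matrixP => s t; rewrite summxE !mxE (bigD1 s) //= big1 ?addr0.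
  by rewrite mxE eqxx eq_sym.
by move=> i si; rewrite mxE eq_sym (negbTE si).
Qed.

(* The Kraus operators of the (anti)symmetric Werner channel. *)
Lemma kraus_transpose (s : C) X : s ^+ 2 = 1 -> s^* = s ->
  (\tr X)%:M + s *: X^T = \sum_(p : 'I_n * 'I_n)
    2^-1 *: ((delta_mx p.1 p.2 + s *: delta_mx p.2 p.1) *m X *m
             (delta_mx p.1 p.2 + s *: delta_mx p.2 p.1)^t*).
Proof.
move=> s2 sr; rewrite -scaler_sumr.
rewrite -(pair_bigA _ (fun i j => (delta_mx i j + s *: delta_mx j i) *m X *m
             (delta_mx i j + s *: delta_mx j i)^t*)) /=.
have E i j : (delta_mx i j + s *: delta_mx j i) *m X *m
             (delta_mx i j + s *: delta_mx j i)^t* =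
   (X j j *: delta_mx i i + X i i *: delta_mx j j) +
   s *: (X j i *: delta_mx i j + X i j *: delta_mx j i).
  rewrite adjD adjZ sr !delta_mx_adj !mulmxDl !mulmxDr -!scalemxAl -!scalemxAr.
  rewrite !delta_mulmx_delta !scalerA -expr2 s2 mul1r.
  by rewrite !scalerDr !scalerA; apply/matrixP => u v; rewrite !mxE; ring.
have T : \sum_i \sum_j X j j *: delta_mx i i = (\tr X)%:M :> 'M[C]_n.
  under eq_bigr do rewrite -scaler_suml -/(\tr X).
  by rewrite -scaler_sumr sum_delta_diag scalemx1.
have D : \sum_i \sum_j X j i *: delta_mx i j = X^T :> 'M[C]_n.
  rewrite [RHS]matrix_sum_delta; apply: eq_bigr => i _.
  by apply: eq_bigr => j _; rewrite mxE.
under eq_bigr do under eq_bigr do rewrite E.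
under eq_bigr do rewrite big_split /= -scaler_sumr !big_split /=.
rewrite big_split /= -scaler_sumr !big_split /= T D.
have T' : \sum_i \sum_j X i i *: delta_mx j j = (\tr X)%:M :> 'M[C]_n.
  by rewrite exchange_big.
have D' : \sum_i \sum_j X i j *: delta_mx j i = X^T :> 'M[C]_n.
  by rewrite exchange_big.
rewrite T' D'.
set t := _%:M; set t' := X^T.
by apply/matrixP => u v; rewrite !mxE; field.
Qed.

Lemma scalar_mx_adj (a : C) : (a%:M : 'M[C]_n)^t* = (a^*)%:M.
Proof. by apply/matrixP => i j; rewrite !mxE rmorphMn eq_sym. Qed.

(** The Kraus operators are the matrix units [E_ij], shifted by [- n^-1] times the identity when
    [i = j]. The diagonal terms then contribute [n^-1 X - 2 n^-1 X] in all. *)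
Lemma kraus_depolarize X : (0 < n)%N ->
  (\tr X)%:M - n%:R^-1 *: X = \sum_(p : 'I_n * 'I_n)
    (delta_mx p.1 p.2 + (- (n%:R^-1 *+ (p.1 == p.2)))%:M) *m X *m
    (delta_mx p.1 p.2 + (- (n%:R^-1 *+ (p.1 == p.2)))%:M)^t*.
Proof.
move=> n0; set c : C := n%:R^-1.
have nc : n%:R * c = 1 by rewrite mulfV // pnatr_eq0 -lt0n.
have cr : c^* = c by rewrite fmorphV rmorph_nat.
rewrite -(pair_bigA _ (fun i j => (delta_mx i j + (- (c *+ (i == j)))%:M) *m X
   *m (delta_mx i j + (- (c *+ (i == j)))%:M)^t*)) /=.
have E i j : (delta_mx i j + (- (c *+ (i == j)))%:M) *m X *m
             (delta_mx i j + (- (c *+ (i == j)))%:M)^t* =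
   X j j *: delta_mx i i + (c *: (c *: X - X *m delta_mx j i -
     delta_mx i j *m X)) *+ (i == j).
  have kr : (- (c *+ (i == j)))^* = - (c *+ (i == j)).
    by rewrite rmorphN rmorphMn /= cr.
  rewrite adjD scalar_mx_adj delta_mx_adj kr.
  rewrite !mulmxDl !mulmxDr !mul_scalar_mx !mul_mx_scalar delta_mulmx_delta.
  rewrite -scalemxAl !scalerA.
  set M1 := delta_mx i j *m X; set M2 := X *m delta_mx j i.
  by case: (i == j); rewrite ?mulr1n ?mulr0n; apply/matrixP => u v;
    rewrite !mxE; ring.
under eq_bigr do under eq_bigr do rewrite E.
under eq_bigr do rewrite big_split /=.
rewrite big_split /=; congr (_ + _).
  under eq_bigr do rewrite -scaler_suml -/(\tr X).
  by rewrite -scaler_sumr sum_delta_diag scalemx1.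
have -> : \sum_i \sum_j (c *: (c *: X - X *m delta_mx j i -
     delta_mx i j *m X)) *+ (i == j) =
  \sum_i c *: (c *: X - X *m delta_mx i i - delta_mx i i *m X).
  apply: eq_bigr => i _; rewrite (bigD1 i) //= big1 ?addr0 ?eqxx //.
  by move=> j ji; rewrite eq_sym (negbTE ji).
rewrite -scaler_sumr !big_split /= !sumrN sumr_const card_ord.
rewrite -mulmx_sumr -mulmx_suml sum_delta_diag mulmx1 mul1mx.
by rewrite -scaler_nat scalerA nc scale1r subrr add0r scalerN.
Qed.

End KrausMaps.

(** * Sending a system through a channel *)

Section Transmission.
Local Open Scope sesquilinear_scope.
Variable R : realType.
Local Notation C := R[i].
Local Notation "x %:C" := (real_complex R x) : ring_scope.

Lemma entry_transmit (S T A B : finType) (E : op R S -> op R T)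
    (X : op R ((A * S) * B)%type) x y :
  entry (transmit E X) x y = entry (E (mklin (fun s s' =>
      entry X ((x.1, s), x.2.2) ((y.1, s'), y.2.2)))) x.2.1 y.2.1.
Proof. by rewrite mklinK. Qed.

Lemma sum_pair3 (V : nmodType) (A S B : finType) (F : A -> S -> B -> V) a b :
  \sum_(w : (A * S) * B) F w.1.1 w.1.2 w.2 *+ ((a == w.1.1) && (b == w.2)) =
  \sum_s F a s b.
Proof.
rewrite -(pair_bigA _ (fun u v => F u.1 u.2 v *+ ((a == u.1) && (b == v)))) /=.
rewrite (eq_bigr (fun u : A * S => F u.1 u.2 b *+ (a == u.1))); last first.
  move=> u _; rewrite (bigD1 b) //= eqxx andbT big1 ?addr0 //.
  by move=> v vb; rewrite [b == v]eq_sym (negbTE vb) andbF.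
rewrite -(pair_bigA _ (fun a' s => F a' s b *+ (a == a'))) /=.
rewrite (bigD1 a) //= [X in _ + X]big1 ?addr0; last first.
  by move=> u ua; apply: big1 => s _; rewrite eq_sym (negbTE ua).
by apply: eq_bigr => s _; rewrite eqxx.
Qed.

(** The functions [a] and [b] read off the registers that [V] leaves untouched; this absorbs the
    regrouping of [(A * S) * B] into [A * (T * B)]. *)
Lemma entry_local_conj (A S B U : finType) (V : lin R ((A * S) * B)%type U)
    (a : U -> A) (b : U -> B) (f : U -> S -> C) (X : op R ((A * S) * B)%type) :
  (forall x w,
    entry V x w = f x w.1.2 *+ ((a x == w.1.1) && (b x == w.2))) ->
  forall x y, entry (V *m X *m V^t* : op R U) x y =
    \sum_s' (\sum_s f x s * entry X (a x, s, b x) (a y, s', b y)) * (f y s')^*.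
Proof.
move=> VE x y; rewrite (entryM (V *m X : lin R _ _)) /=.
rewrite -(sum_pair3 (fun u s' v => (\sum_s f x s *
  entry X (a x, s, b x) (u, s', v)) * (f y s')^*)).
apply: eq_bigr => -[[u s'] v] _ /=; rewrite (entry_trC V) VE rmorphMn mulrnAr /=.
congr (_ * _ *+ _); rewrite (entryM V X).
rewrite -(sum_pair3 (fun t s w => f x s * entry X (t, s, w) (u, s', v))).
by apply: eq_bigr => -[[t s] w] _ /=; rewrite VE mulrnAl.
Qed.

(** Complete positivity: each Kraus operator of [E], tensored with the identity on both registers,
    gives a Kraus operator [V i] of the transmission. *)
Lemma psd_transmit (S T A B I : finType) (E : op R S -> op R T)
    (K : I -> lin R S T) (X : op R ((A * S) * B)%type) :
  (forall rho, E rho = \sum_i K i *m rho *m (K i)^t*) ->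
  psd X -> psd (transmit E X).
Proof.
move=> EK Xpsd.
pose V i : lin R ((A * S) * B)%type (A * (T * B))%type := mklin (fun x w =>
  entry (K i) x.2.1 w.1.2 *+ ((x.1 == w.1.1) && (x.2.2 == w.2))).
suff -> : transmit E X = \sum_i V i *m X *m (V i)^t*.
  by apply: psd_sum => i; exact: psd_conj.
apply: entryP => x y; rewrite entry_transmit EK !entry_sum.
apply: eq_bigr => i _.
rewrite (@entry_local_conj _ _ _ _ (V i) (fun x => x.1) (fun x => x.2.2)
  (fun x s => entry (K i) x.2.1 s)); last by move=> ? ?; rewrite mklinK.
set Y := mklin _; rewrite (entryM (K i *m Y)).
apply: eq_bigr => s' _; rewrite entry_trC; congr (_ * _).
by rewrite entryM; apply: eq_bigr => s _; rewrite mklinK.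
Qed.

(** The family containing the Holevo-Werner channels and their symmetric and antisymmetric
    components. The next family, of depolarizing type, is what it becomes under partial
    transposition. *)
Definition twchan (T : finType) (u v : R) (rho : op R T) : op R T :=
  u%:C *: (\tr rho)%:M + v%:C *: rho^T.
Definition isochan (T : finType) (u v : R) (rho : op R T) : op R T :=
  u%:C *: (\tr rho)%:M + v%:C *: rho.

Section Channels.
Variables T A B : finType.
Implicit Types X Y : op R ((A * T) * B)%type.

Lemma entry_transmit_twchan u v X x y :
  entry (transmit (@twchan T u v) X) x y =
  u%:C * ((\sum_s entry X ((x.1, s), x.2.2) ((y.1, s), y.2.2)) *+
          (x.2.1 == y.2.1)) +
  v%:C * entry X ((x.1, y.2.1), x.2.2) ((y.1, x.2.1), y.2.2).
Proof.
rewrite entry_transmit /twchan entryD !entryZ entry_scalar entry_tr mklinK.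
by rewrite trace_entry; under eq_bigr do rewrite mklinK.
Qed.

Lemma entry_transmit_isochan u v X x y :
  entry (transmit (@isochan T u v) X) x y =
  u%:C * ((\sum_s entry X ((x.1, s), x.2.2) ((y.1, s), y.2.2)) *+
          (x.2.1 == y.2.1)) +
  v%:C * entry X ((x.1, x.2.1), x.2.2) ((y.1, y.2.1), y.2.2).
Proof.
rewrite entry_transmit /isochan entryD !entryZ entry_scalar mklinK.
by rewrite trace_entry; under eq_bigr do rewrite mklinK.
Qed.

(** The output system belongs to Bob, so partial transposition undoes the transpose in [twchan]; the
    input system belongs to Alice and is left alone. *)
Lemma ptranspose_transmit u v X :
  ptranspose (transmit (@twchan T u v) X) =
  transmit (@isochan T u v) (ptranspose X).
Proof.
apply: entryP => x y.
rewrite entry_ptranspose entry_transmit_isochan entry_transmit_twchan /=.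
under [in RHS]eq_bigr do rewrite entry_ptranspose.
by rewrite entry_ptranspose [y.2.1 == _]eq_sym.
Qed.

Lemma transmit_twchanD u v c X Y :
  transmit (@twchan T u v) (c *: X + Y) =
  c *: transmit (@twchan T u v) X + transmit (@twchan T u v) Y.
Proof.
apply: entryP => x y; rewrite [RHS]entryD.
rewrite [X in _ = X + _]entryZ [LHS]entry_transmit_twchan.
rewrite [X in _ = _ * X + _]entry_transmit_twchan [X in _ = _ + X]entry_transmit_twchan.
under eq_bigr do rewrite entryD entryZ.
rewrite big_split -mulr_sumr entryD entryZ /=; ring.
Qed.

Lemma transmit_isochanD u v c X Y :
  transmit (@isochan T u v) (c *: X + Y) =
  c *: transmit (@isochan T u v) X + transmit (@isochan T u v) Y.
Proof.
apply: entryP => x y; rewrite [RHS]entryD.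
rewrite [X in _ = X + _]entryZ [LHS]entry_transmit_isochan.
rewrite [X in _ = _ * X + _]entry_transmit_isochan [X in _ = _ + X]entry_transmit_isochan.
under eq_bigr do rewrite entryD entryZ.
rewrite big_split -mulr_sumr entryD entryZ /=; ring.
Qed.

Lemma transmit_twchan_comb (p q u v u' v' : R) X :
  transmit (@twchan T (p * u + q * u') (p * v + q * v')) X =
  p%:C *: transmit (@twchan T u v) X + q%:C *: transmit (@twchan T u' v') X.
Proof.
apply: entryP => x y; rewrite [RHS]entryD [X in _ = X + _]entryZ [X in _ = _ + X]entryZ.
rewrite [LHS]entry_transmit_twchan [X in _ = _ * X + _]entry_transmit_twchan.
rewrite [X in _ = _ + _ * X]entry_transmit_twchan !rmorphD !rmorphM /=; ring.
Qed.

Lemma transmit_isochan_comb (p q u v u' v' : R) X :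
  transmit (@isochan T (p * u + q * u') (p * v + q * v')) X =
  p%:C *: transmit (@isochan T u v) X + q%:C *: transmit (@isochan T u' v') X.
Proof.
apply: entryP => x y; rewrite [RHS]entryD [X in _ = X + _]entryZ [X in _ = _ + X]entryZ.
rewrite [LHS]entry_transmit_isochan [X in _ = _ * X + _]entry_transmit_isochan.
rewrite [X in _ = _ + _ * X]entry_transmit_isochan !rmorphD !rmorphM /=; ring.
Qed.

Lemma sum_pair3_swap (F : A -> T -> B -> C) :
  \sum_(x : A * (T * B)) F x.1 x.2.1 x.2.2 =
  \sum_(x : (A * T) * B) F x.1.1 x.1.2 x.2.
Proof.
rewrite -(pair_bigA _ (fun a (tb : T * B) => F a tb.1 tb.2)) /=.
rewrite -(pair_bigA _ (fun (at_ : A * T) b => F at_.1 at_.2 b)) /=.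
rewrite -(pair_bigA _ (fun a t => \sum_b F a t b)) /=.
by apply: eq_bigr => a _; rewrite -(pair_bigA _ (fun t b => F a t b)).
Qed.

Lemma tr_transmit_isochan u v X :
  \tr (transmit (@isochan T u v) X) = (u * #|T|%:R + v)%:C * \tr X.
Proof.
rewrite !trace_entry; under eq_bigr do rewrite entry_transmit_isochan eqxx mulr1n.
rewrite big_split /= -!mulr_sumr.
rewrite (sum_pair3_swap (fun a t b => entry X (a, t, b) (a, t, b))).
rewrite (sum_pair3_swap (fun a t b => \sum_s entry X (a, s, b) (a, s, b))).
rewrite -(pair_bigA _ (fun (at_ : A * T) b => \sum_s entry X (at_.1, s, b) (at_.1, s, b))) /=.
rewrite -(pair_bigA _ (fun a (t : T) => \sum_b \sum_s entry X (a, s, b) (a, s, b))) /=.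
set t1 := \sum_(x : A * T * B) _.
suff -> : \sum_a \sum_(t : T) \sum_b \sum_s entry X (a, s, b) (a, s, b) =
    #|T|%:R * t1.
  have -> : \sum_i entry X i i = t1 by apply: eq_bigr => -[[? ?] ?].
  by rewrite rmorphD rmorphM rmorph_nat; ring.
rewrite /t1 -(pair_bigA _ (fun (at_ : A * T) b => entry X (at_.1, at_.2, b) (at_.1, at_.2, b))) /=.
rewrite -(pair_bigA _ (fun a (t : T) => \sum_b entry X (a, t, b) (a, t, b))) /=.
rewrite mulr_sumr; apply: eq_bigr => a _.
by rewrite sumr_const mulr_natl exchange_big.
Qed.

Lemma tr_transmit_twchan u v X :
  \tr (transmit (@twchan T u v) X) = (u * #|T|%:R + v)%:C * \tr X.
Proof.
by rewrite -tr_ptranspose ptranspose_transmit tr_transmit_isochan tr_ptranspose.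
Qed.

Lemma psd_transmit_twchan (s : R) X : s ^+ 2 = 1 ->
  psd X -> psd (transmit (@twchan T 1 s) X).
Proof.
(* The factor [2^-1] of [kraus_transpose] is split between the operator and its adjoint. *)
move=> s2; pose K (p : 'I_#|T| * 'I_#|T|) : op R T :=
  (Num.sqrt 2^-1)%:C *: (delta_mx p.1 p.2 + s%:C *: delta_mx p.2 p.1).
apply: (@psd_transmit _ _ _ _ _ _ K) => rho.
rewrite /twchan scale1r kraus_transpose ?conjC_real //; last first.
  by rewrite -rmorphXn s2.
apply: eq_bigr => p _.
rewrite /K adjZ conjC_real -!scalemxAl -scalemxAr scalerA -rmorphM.
by rewrite -expr2 sqr_sqrtr ?invr_ge0 // fmorphV rmorph_nat.
Qed.

Lemma psd_transmit_isochan X : (0 < #|T|)%N ->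
  psd X -> psd (transmit (@isochan T 1 (- #|T|%:R^-1)) X).
Proof.
move=> T0; apply: psd_transmit => rho.
rewrite /isochan scale1r rmorphN fmorphV rmorph_nat scaleNr.
exact: kraus_depolarize.
Qed.

End Channels.

End Transmission.

(** * LOCC maps *)

Section LOCCProperties.
Local Open Scope sesquilinear_scope.
Variable R : realType.
Local Notation C := R[i].
Local Notation "x %:C" := (real_complex R x) : ring_scope.

Lemma tensorM (T T' T'' U U' U'' : finType) (M : lin R T' T'') (M' : lin R T T')
    (N : lin R U' U'') (N' : lin R U U') :
  tensor M N *m tensor M' N' = tensor (M *m M') (N *m N').
Proof.
apply: entryP => x y; rewrite (entryM (tensor M N)) mklinK !entryM.
rewrite big_distrlr /= pair_bigA; apply: eq_bigr => -[a b] _ /=.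
by rewrite !mklinK /=; ring.
Qed.

Lemma tensor_adj (T T' U U' : finType) (M : lin R T T') (N : lin R U U') :
  (tensor M N)^t* = tensor (M^t*) (N^t*).
Proof.
apply: entryP => x y; rewrite (entry_trC (tensor M N)) !mklinK rmorphM.
by rewrite !entry_trC.
Qed.

Lemma tensor1 (T U : finType) :
  tensor (1%:M : op R T) (1%:M : op R U) = 1%:M.
Proof.
apply: entryP => -[a b] [a' b']; rewrite mklinK !entry_scalar xpair_eqE /=.
by case: (a == a'); case: (b == b'); rewrite /= ?(mulr1, mulr0).
Qed.

Lemma adj1 n : (1%:M : 'M[C]_n)^t* = 1%:M.
Proof. by rewrite scalar_mx_adj rmorph1. Qed.

Lemma tensor_suml (T U I : finType) (M : I -> op R T) :
  \sum_i tensor (M i) (1%:M : op R U) = tensor (\sum_i M i : op R T) (1%:M : op R U).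
Proof.
apply: entryP => x y; rewrite entry_sum mklinK entry_sum mulr_suml.
by apply: eq_bigr => i _; rewrite mklinK.
Qed.

Lemma tensor_sumr (T U I : finType) (M : I -> op R T) :
  \sum_i tensor (1%:M : op R U) (M i) = tensor (1%:M : op R U) (\sum_i M i : op R T).
Proof.
apply: entryP => x y; rewrite entry_sum mklinK entry_sum mulr_sumr.
by apply: eq_bigr => i _; rewrite mklinK.
Qed.

(** * Local operators under partial transposition *)

Section LocalConj.
Variables A B U : finType.
Implicit Types X : op R (A * B)%type.

Lemma sum_pair_fst (V : nmodType) (F : A -> B -> V) b :
  \sum_(w : A * B) F w.1 w.2 *+ (b == w.2) = \sum_a F a b.
Proof.
rewrite -(pair_bigA _ (fun u v => F u v *+ (b == v))) /=.
apply: eq_bigr => u _; rewrite (bigD1 b) //= eqxx big1 ?addr0 //.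
by move=> v vb; rewrite eq_sym (negbTE vb).
Qed.

Lemma sum_pair_snd (V : nmodType) (F : A -> B -> V) a :
  \sum_(w : A * B) F w.1 w.2 *+ (a == w.1) = \sum_b F a b.
Proof.
rewrite -(pair_bigA _ (fun u v => F u v *+ (a == u))) /= exchange_big /=.
apply: eq_bigr => u _; rewrite (bigD1 a) //= eqxx big1 ?addr0 //.
by move=> v vb; rewrite eq_sym (negbTE vb).
Qed.

Lemma entry_conj_alice (M : lin R A U) X x y :
  entry (tensor M (1%:M : op R B) *m X *m (tensor M (1%:M : op R B))^t* :
    op R (U * B)%type) x y =
  \sum_w (\sum_z entry M x.1 z * entry X (z, x.2) (w, y.2)) * (entry M y.1 w)^*.
Proof.
set V := tensor M _; rewrite (entryM (V *m X : lin R _ _)).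
rewrite -(sum_pair_fst (fun w v =>
  (\sum_z entry M x.1 z * entry X (z, x.2) (w, v)) * (entry M y.1 w)^*)).
have VE p q : entry V p q = entry M p.1 q.1 *+ (p.2 == q.2).
  by rewrite mklinK entry_scalar mulrnAr mulr1.
apply: eq_bigr => -[w v] _ /=; rewrite (entry_trC V) VE rmorphMn mulrnAr /=.
congr (_ * _ *+ _); rewrite (entryM V X).
rewrite -(sum_pair_fst (fun z u => entry M x.1 z * entry X (z, u) (w, v))).
by apply: eq_bigr => -[z u] _ /=; rewrite VE mulrnAl.
Qed.

Lemma entry_conj_bob (M : lin R B U) X x y :
  entry (tensor (1%:M : op R A) M *m X *m (tensor (1%:M : op R A) M)^t* :
    op R (A * U)%type) x y =
  \sum_w (\sum_z entry M x.2 z * entry X (x.1, z) (y.1, w)) * (entry M y.2 w)^*.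
Proof.
set V := tensor _ M; rewrite (entryM (V *m X : lin R _ _)).
rewrite -(sum_pair_snd (fun v w =>
  (\sum_z entry M x.2 z * entry X (x.1, z) (v, w)) * (entry M y.2 w)^*)).
have VE p q : entry V p q = entry M p.2 q.2 *+ (p.1 == q.1).
  by rewrite mklinK entry_scalar mulrnAl mul1r.
apply: eq_bigr => -[v w] _ /=; rewrite (entry_trC V) VE rmorphMn mulrnAr /=.
congr (_ * _ *+ _); rewrite (entryM V X).
rewrite -(sum_pair_snd (fun u z => entry M x.2 z * entry X (u, z) (v, w))).
by apply: eq_bigr => -[z u] _ /=; rewrite VE mulrnAl.
Qed.

Lemma ptranspose_conj_alice (M : lin R A U) X :
  ptranspose (tensor M (1%:M : op R B) *m X *m
     (tensor M (1%:M : op R B))^t* : op R (U * B)%type) =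
  tensor M (1%:M : op R B) *m ptranspose X *m (tensor M (1%:M : op R B))^t*.
Proof.
apply: entryP => x y; rewrite entry_ptranspose !entry_conj_alice /=.
by apply: eq_bigr => w _; congr (_ * _); apply: eq_bigr => z _;
  rewrite entry_ptranspose.
Qed.

Definition conj_lin (M : lin R B U) : lin R B U := mklin (fun u b => (entry M u b)^*).

(** Transposing Bob's side exchanges his operator with its adjoint on the other side, which amounts
    to replacing it by its entrywise conjugate; the result is again a conjugation, hence
    positive. *)
Lemma ptranspose_conj_bob (M : lin R B U) X :
  ptranspose (tensor (1%:M : op R A) M *m X *m
     (tensor (1%:M : op R A) M)^t* : op R (A * U)%type) =
  tensor (1%:M : op R A) (conj_lin M) *m ptranspose X *m
    (tensor (1%:M : op R A) (conj_lin M))^t*.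
Proof.
apply: entryP => x y; rewrite entry_ptranspose !entry_conj_bob /=.
under eq_bigr do rewrite mulr_suml.
rewrite exchange_big /=; apply: eq_bigr => w _; rewrite mulr_suml.
by apply: eq_bigr => z _; rewrite entry_ptranspose !mklinK conjCK /=; ring.
Qed.

End LocalConj.

(** These are the properties through which LOCC maps enter the argument. The last one says that the
    conjugate of [L] by partial transposition is again positive. *)
Record ppt_map (A B A' B' : finType)
    (L : op R (A * B)%type -> op R (A' * B')%type) : Prop := PPTMap {
  ppt_linear : forall c X Y, L (c *: X + Y) = c *: L X + L Y;
  ppt_trace : forall X, \tr (L X) = \tr X;
  ppt_psd : forall X, psd X -> psd (L X);
  ppt_ptranspose : forall X, psd (ptranspose X) -> psd (ptranspose (L X)) }.

(** One round of communication. [AB k] is the pair of registers after outcome [k], so that Alice's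
    and Bob's rounds are instances of the same statement. *)
Lemma ppt_map_sum (A B A' B' K : finType) (AB : K -> finType * finType)
    (V : forall k, lin R (A * B)%type ((AB k).1 * (AB k).2)%type)
    (F : forall k, op R ((AB k).1 * (AB k).2)%type -> op R (A' * B')%type) :
  \sum_k (V k)^t* *m V k = 1%:M ->
  (forall k X, psd (ptranspose X) ->
     psd (ptranspose (V k *m X *m (V k)^t* :
       op R ((AB k).1 * (AB k).2)%type))) ->
  (forall k, ppt_map (F k)) ->
  ppt_map (fun X => \sum_k F k (V k *m X *m (V k)^t*)).
Proof.
move=> V1 VP FP; split.
- move=> c X Y; rewrite scaler_sumr -big_split; apply: eq_bigr => k _ /=.
  by rewrite -(ppt_linear (FP k)) mulmxDr mulmxDl -scalemxAr -scalemxAl.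
- move=> X; rewrite raddf_sum /=.
  under eq_bigr => k _ do rewrite (ppt_trace (FP k)) mxtrace_mulC mulmxA.
  by rewrite -raddf_sum -mulmx_suml V1 mul1mx.
- by move=> X Xp; apply: psd_sum => k; apply: (ppt_psd (FP k)); exact: psd_conj.
- move=> X Xp; rewrite ptranspose_sum; apply: psd_sum => k.
  by apply: (ppt_ptranspose (FP k)); exact: VP.
Qed.

Lemma LOCC_ppt_map (A B A' B' : finType)
    (L : op R (A * B)%type -> op R (A' * B')%type) : LOCC L -> ppt_map L.
Proof.
elim=> {A B A' B' L}.
- by move=> A B; split.
- move=> A B A' B' K Ak M F M1 _ FP.
  apply: (@ppt_map_sum A B A' B' K (fun k => (Ak k, B))
    (fun k => tensor (M k) (1%:M : op R B)) F _ _ FP).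
    under eq_bigr do rewrite tensor_adj tensorM adj1 mul1mx.
    by rewrite tensor_suml M1 tensor1.
  by move=> k X Xp; rewrite ptranspose_conj_alice; exact: psd_conj.
- move=> A B A' B' K Bk M F M1 _ FP.
  apply: (@ppt_map_sum A B A' B' K (fun k => (A, Bk k))
    (fun k => tensor (1%:M : op R A) (M k)) F _ _ FP).
    under eq_bigr do rewrite tensor_adj tensorM adj1 mul1mx.
    by rewrite tensor_sumr M1 tensor1.
  by move=> k X Xp; rewrite ptranspose_conj_bob; exact: psd_conj.
Qed.

Section PPTMapLinear.
Variables A B A' B' : finType.
Variable L : op R (A * B)%type -> op R (A' * B')%type.
Hypothesis LP : ppt_map L.

Lemma ppt_map0 : L 0 = 0.
Proof.
have := ppt_linear LP (-1) 0 0.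
by rewrite !scaleN1r oppr0 addr0 addNr.
Qed.

Lemma ppt_mapD X Y : L (X + Y) = L X + L Y.
Proof. by have := ppt_linear LP 1 X Y; rewrite !scale1r. Qed.

Lemma ppt_mapZ c X : L (c *: X) = c *: L X.
Proof. by have := ppt_linear LP c X 0; rewrite ppt_map0 !addr0. Qed.

Lemma ppt_map_lincomb (I : finType) (c : I -> C) (X : I -> op R (A * B)%type) :
  L (\sum_i c i *: X i) = \sum_i c i *: L (X i).
Proof.
apply: (big_ind2 (fun u v => L u = v)) => [|x x' y y' <- <-|i _].
- exact: ppt_map0.
- exact: ppt_mapD.
- exact: ppt_mapZ.
Qed.

End PPTMapLinear.

End LOCCProperties.

(** * Spectra of the flip and of the maximally entangled state *)

Section Spectral.
Local Open Scope sesquilinear_scope.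
Variable R : realType.
Local Notation C := R[i].
Local Notation "x %:C" := (real_complex R x) : ring_scope.

Lemma herm_opdiag (T : finType) (A : op R T) : A^t* = A ->
  exists (U : op R T) (e : T -> R), U \is unitarymx /\ A = opdiag U e.
Proof.
move=> hA; exists (spectralmx A).
exists (fun t => complex.Re (spectral_diag A 0 (enum_rank t))).
split; first exact: spectral_unitarymx.
rewrite [LHS](herm_udiag hA); apply: eq_udiag => i.
by rewrite enum_valK.
Qed.

Lemma mxtrace_lincomb n (x y : C) (A B : 'M[C]_n) :
  \tr (x *: A + y *: B) = x * \tr A + y * \tr B.
Proof. by rewrite mxtraceD !mxtraceZ. Qed.

Lemma mxtraceB n (A B : 'M[C]_n) : \tr (A - B) = \tr A - \tr B.
Proof. exact: raddfB. Qed.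

Lemma Re_trM_lincomb n (I : finType) (A : 'M[C]_n) (c : I -> R)
    (X : I -> 'M[C]_n) :
  complex.Re (\tr (A *m \sum_i (c i)%:C *: X i)) =
  \sum_i c i * complex.Re (\tr (A *m X i)).
Proof.
rewrite mulmx_sumr (big_morph _ (@mxtraceD _ n) (@mxtrace0 _ n)) Re_sum.
by apply: eq_bigr => i _; rewrite -scalemxAr mxtraceZ ReM_real.
Qed.

Lemma sum_pairE (V : nmodType) (A B : finType) (F : A * B -> V) :
  \sum_t F t = \sum_a \sum_b F (a, b).
Proof.
by rewrite (pair_bigA _ (fun a b => F (a, b))); apply: eq_bigr => -[].
Qed.

Section Opdiag.
Variables (T : finType) (U : op R T).
Implicit Types e : T -> R.

Lemma opdiagD e e' : opdiag U (fun t => e t + e' t) = opdiag U e + opdiag U e'.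
Proof. exact: udiagD. Qed.

Lemma opdiagZ c e : opdiag U (fun t => c * e t) = c%:C *: opdiag U e.
Proof. exact: udiagZ. Qed.

Lemma psd_opdiag e : (forall t, 0 <= e t) -> psd (opdiag U e).
Proof. by move=> e0; apply: psd_udiag => i; exact: e0. Qed.

Lemma psd_tr_opdiagM e (B : op R T) :
  (forall t, 0 <= e t) -> psd B -> 0 <= \tr (opdiag U e *m B).
Proof. by move=> e0; apply: psd_tr_udiagM => i; exact: e0. Qed.

Hypothesis UU : U \is unitarymx.

Lemma opdiagM e e' : opdiag U e *m opdiag U e' = opdiag U (fun t => e t * e' t).
Proof. exact: udiagM. Qed.

Lemma tr_opdiag e : \tr (opdiag U e) = (\sum_t e t)%:C.
Proof. by rewrite /opdiag (tr_udiag UU) sum_enum_val. Qed.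

Lemma opdiag_cst c : opdiag U (fun=> c) = (c%:C)%:M.
Proof. exact: udiag_cst. Qed.

Lemma opdiag_affine x y e :
  opdiag U (fun t => x + y * e t) = (x%:C)%:M + y%:C *: opdiag U e.
Proof. by rewrite opdiagD opdiagZ opdiag_cst. Qed.

Lemma opdiag_inj e e' : opdiag U e = opdiag U e' -> e =1 e'.
Proof.
by move=> /(udiag_inj UU) h t; have := h (enum_rank t); rewrite /= enum_rankK.
Qed.

(** A form of Hölder's inequality. With [A = opdiag U e], the nonnegative traces of [(k - A)(Z + X)]
    and [(k + A)(Z - X)] add up to twice [k Tr Z - Tr A X]. *)
Lemma tr_opdiagM_bound e k (X Z : op R T) :
  (forall t, `|e t| <= k) -> psd (Z + X) -> psd (Z - X) ->
  complex.Re (\tr (opdiag U e *m X)) <= k * complex.Re (\tr Z).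
Proof.
move=> ek Zp Zm.
have h1 : 0 <= \tr (opdiag U (fun t => k + (-1) * e t) *m (Z + X)).
  apply: psd_tr_opdiagM => // t; rewrite mulN1r subr_ge0.
  exact: le_trans (ler_norm _) (ek t).
have h2 : 0 <= \tr (opdiag U (fun t => k + 1 * e t) *m (Z - X)).
  apply: psd_tr_opdiagM => // t; rewrite mul1r -lerBlDl sub0r /=.
  by have := ek t; rewrite ler_norml => /andP[].
have := addr_ge0 h1 h2; rewrite !opdiag_affine.
rewrite rmorphN rmorph1 scaleN1r scale1r.
set A := opdiag U e.
have -> : \tr ((k%:C%:M - A) *m (Z + X)) + \tr ((k%:C%:M + A) *m (Z - X)) =
    (k%:C * \tr Z - \tr (A *m X)) *+ 2.
  rewrite !mulmxDl !mulmxDr !mulNmx !mulmxN !mul_scalar_mx.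
  rewrite !mxtraceD !raddfN /= !mxtraceZ; ring.
rewrite (pmulrn_lge0 _ (isT : (0 < 2)%N)) => /Re_le.
by rewrite ReD ReN ReM_real subr_ge0.
Qed.

End Opdiag.

(** In an eigenbasis a polynomial identity for the operator is the same identity for each
    eigenvalue. The spectra of the flip and of its partial transpose come from their squares in this
    way. *)
Lemma opdiag_quadratic (T : finType) (A : op R T) (x y : R) :
  A^t* = A -> A *m A = x%:C *: A + (y%:C)%:M ->
  exists (U : op R T) (e : T -> R), [/\ U \is unitarymx, A = opdiag U e &
    forall t, e t * e t = x * e t + y].
Proof.
move=> /herm_opdiag[U [e [UU AE]]] AA; exists U, e; split => //.
apply: (opdiag_inj UU); rewrite -(opdiagM UU) -AE AA opdiagD opdiagZ -AE.
by rewrite (opdiag_cst UU).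
Qed.

(** In the eigenbasis of [X] the diagonal entries of [P] lie in [0, 1], while the trace norm is the
    sum of the absolute values of the eigenvalues. *)
Lemma tr_norm_bound n (P X : 'M[C]_n) : psd P -> psd (1%:M - P) -> X^t* = X ->
  - trace_norm X <= complex.Re (\tr (P *m X)).
Proof.
move=> P0 P1 hX; rewrite /trace_norm hX.
set S := spectralmx X; set l := fun i => complex.Re (spectral_diag X 0 i).
have SS : S \is unitarymx := spectral_unitarymx X.
have XE : X = udiag S l := herm_udiag hX.
rewrite [X in X *m X]XE (udiagM SS) (herm_fun_udiag _ _ SS) (tr_udiag SS) /=.
rewrite mxtrace_mulC XE tr_udiagM Re_sum -sumrN; apply: ler_sum => i _.
rewrite ReM_real -expr2 sqrtr_sqr.
have h0 := psd_diag_ge0 i (psd_conj S P0).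
have h1 := psd_diag_ge0 i (psd_conj S P1).
have {h1} : (S *m P *m S^t*) i i <= 1.
  move: h1; rewrite mulmxBr mulmx1 mulmxBl (unitarymxP SS) !mxE eqxx.
  by rewrite subr_ge0.
move: h0 => /Re_le /= h0 /Re_le /= h1.
set z := complex.Re _ in h0 h1 *.
rewrite lerNl -mulNr; apply: (le_trans (ler_norm _)).
by rewrite normrM normrN (ger0_norm h0) ler_piMr.
Qed.

(** * The flip, its partial transpose and the ebits *)

Lemma flip_adj d : (flip R d)^t* = flip R d.
Proof.
apply: entryP => x y; rewrite (entry_trC (flip R d)) !mklinK rmorph_nat.
by rewrite andbC [y.1 == _]eq_sym [y.2 == _]eq_sym.
Qed.

Lemma flipM d : flip R d *m flip R d = 1%:M.
Proof.
apply: entryP => -[a b] [a' b'].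
rewrite (entryM (flip R d) (flip R d)) entry_scalar xpair_eqE.
rewrite (bigD1 (b, a)) //= big1 ?addr0; last first.
  move=> [u v]; rewrite xpair_eqE !mklinK /= => uv.
  by rewrite [b == u]eq_sym [a == v]eq_sym andbC (negbTE uv) mul0r.
by rewrite !mklinK /= !eqxx mul1r andbC.
Qed.

(** This is [\sum_(i, j) |ii><jj|], that is, [d] times the projector onto the maximally entangled
    vector. *)
Definition flip_pt d : op R ('I_d * 'I_d)%type := ptranspose (flip R d).

Lemma entry_flip_pt d x y :
  entry (flip_pt d) x y = ((x.1 == x.2) && (y.1 == y.2))%:R.
Proof. by rewrite entry_ptranspose mklinK /= [y.2 == _]eq_sym. Qed.

Lemma flip_pt_adj d : (flip_pt d)^t* = flip_pt d.
Proof.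
apply: entryP => x y; rewrite (entry_trC (flip_pt d)) !entry_flip_pt rmorph_nat.
by rewrite andbC.
Qed.

Lemma flip_ptM d : flip_pt d *m flip_pt d = d%:R *: flip_pt d.
Proof.
apply: entryP => x y; rewrite (entryM (flip_pt d) (flip_pt d)) entryZ.
rewrite sum_pairE.
under eq_bigr => a _.
  rewrite (bigD1 a) //= big1 ?addr0.
    rewrite !entry_flip_pt eqxx andbT /=; over.
  by move=> b ba; rewrite !entry_flip_pt /= [a == b]eq_sym (negbTE ba) andbF mul0r.
rewrite sumr_const card_ord entry_flip_pt -[LHS]mulr_natl; congr (_ * _).
by case: (x.1 == x.2); case: (y.1 == y.2); rewrite /= ?mulr0 ?mulr1.
Qed.

Lemma tr_flip d : \tr (flip R d) = d%:R.
Proof.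
rewrite trace_entry sum_pairE.
under eq_bigr => a _.
  rewrite (bigD1 a) //= big1 ?addr0.
    rewrite !mklinK eqxx /=; over.
  by move=> b ba; rewrite !mklinK /= [a == b]eq_sym (negbTE ba).
by rewrite sumr_const card_ord.
Qed.

Lemma tr_flip_pt d : \tr (flip_pt d) = d%:R.
Proof. by rewrite tr_ptranspose tr_flip. Qed.

(** The square being 1 leaves the eigenvalues 1 and -1; the value of the trace then encodes their
    multiplicities. *)
Lemma flip_opdiag d : exists (U : op R ('I_d * 'I_d)%type) e,
  [/\ U \is unitarymx, flip R d = opdiag U e,
      forall t, e t = 1 \/ e t = -1 & \sum_t e t = d%:R].
Proof.
have [U [e [UU fE e2]]] : exists U e, [/\ U \is unitarymx, flip R d = opdiag U e &
    forall t, e t * e t = 0 * e t + 1].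
  apply: opdiag_quadratic; first exact: flip_adj.
  by rewrite flipM rmorph0 scale0r add0r rmorph1.
exists U, e; split => //.
  move=> t; have /eqP := e2 t; rewrite mul0r add0r -expr2 sqrf_eq1.
  by case/orP => /eqP; auto.
have := tr_flip d; rewrite fE (tr_opdiag UU) -(rmorph_nat (real_complex R)).
exact: complexI.
Qed.

Lemma flip_pt_opdiag d : exists (U : op R ('I_d * 'I_d)%type) e,
  [/\ U \is unitarymx, flip_pt d = opdiag U e,
      forall t, e t = 0 \/ e t = d%:R & \sum_t e t = d%:R].
Proof.
have [U [e [UU fE e2]]] : exists U e, [/\ U \is unitarymx, flip_pt d = opdiag U e &
    forall t, e t * e t = d%:R * e t + 0].
  apply: opdiag_quadratic; first exact: flip_pt_adj.
  by rewrite flip_ptM rmorph_nat rmorph0 ?raddf0 addr0.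
exists U, e; split => //.
  move=> t; have /eqP := e2 t; rewrite addr0 -subr_eq0 -mulrBl mulf_eq0.
  by rewrite subr_eq0; case/orP => /eqP; auto.
have := tr_flip_pt d; rewrite fE (tr_opdiag UU) -(rmorph_nat (real_complex R)).
exact: complexI.
Qed.

Lemma ebitE : ebit R = (2^-1)%:C *: flip_pt 2.
Proof.
apply: entryP => x y; rewrite entryZ entry_flip_pt mklinK fmorphV rmorph_nat.
by case: ifP; rewrite ?mulr1 ?mulr0.
Qed.

(** Eigenvalues in {0, 1} with sum 1: a projector of rank one. *)
Lemma bipow_ebit_opdiag m : exists U e,
  [/\ U \is unitarymx, bipow m (ebit R) = opdiag U e,
      forall t, e t = 0 \/ e t = 1 & \sum_t e t = 1].
Proof.
have [U [e [UU fE e01 se]]] := flip_pt_opdiag 2.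
exists (bipow m U).
exists (fun z : {ffun 'I_m -> 'I_2} * {ffun 'I_m -> 'I_2} =>
  \prod_i (2^-1 * e (z.1 i, z.2 i))); split.
- exact: bipow_unitary.
- by rewrite ebitE fE -opdiagZ bipow_opdiag.
- move=> t; elim/big_rec: _ => [|i x _ [->|->]]; [by right|left; exact: mulr0|].
  have [->|->] := e01 (t.1 i, t.2 i); rewrite ?mulr0 ?mul0r; [by left|right].
  by rewrite mulVf ?pnatr_eq0 ?mul1r.
rewrite (@sum_prod_pair _ _ _ _ (fun i z => 2^-1 * e z)).
rewrite -mulr_sumr se mulVf ?pnatr_eq0 // big1 //.
Qed.

(** The partial transpose of an ebit is half the flip, whose eigenvalues are [2^-1] and [- 2^-1].
    This is the source of the factor [2^-m] in the capacity bound. *)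
Lemma ptranspose_ebit_opdiag m : exists U e,
  [/\ U \is unitarymx, ptranspose (bipow m (ebit R)) = opdiag U e &
      forall t, `|e t| <= 2^-1 ^+ m].
Proof.
have [U [e [UU fE e1 _]]] := flip_opdiag 2.
exists (bipow m U).
exists (fun z : {ffun 'I_m -> 'I_2} * {ffun 'I_m -> 'I_2} =>
  \prod_i (2^-1 * e (z.1 i, z.2 i))); split.
- exact: bipow_unitary.
- by rewrite ptranspose_bipow ebitE ptransposeZ ptransposeK fE -opdiagZ bipow_opdiag.
move=> t; rewrite normr_prod (eq_bigr (fun=> 2^-1)).
  by rewrite prodr_const card_ord.
move=> i _; rewrite normrM ger0_norm ?invr_ge0 //.
by have [->|->] := e1 (t.1 i, t.2 i); rewrite ?normrN normr1 mulr1.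
Qed.

End Spectral.

(** * Adaptive protocols *)

Section AdaptiveProtocols.
Local Open Scope sesquilinear_scope.
Variable R : realType.
Local Notation C := R[i].
Local Notation "x %:C" := (real_complex R x) : ring_scope.
(** [p] and [q] are the probabilities of the symmetric and antisymmetric channels, [a] and [b] the
    weights of the comparison operator, [l1] and [l2] the natural logarithms of the ratios. [pa] and
    [qb] are inequalities with [expR], which also covers a ratio equal to 0. [f] and [v] are the
    mean and variance of the log-ratio in one round. The left side of [ab1] is the trace norm of the
    partial transpose of [a W_+ + b W_-]. *)
Variables (d : nat) (p q a b l1 l2 : R).
Local Notation D := (d%:R : R).
Local Notation f := (p * l1 + q * l2).
Local Notation v := (p * (l1 - f) ^+ 2 + q * (l2 - f) ^+ 2).
Hypothesis d2 : (2 <= d)%N.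
Hypotheses (p0 : 0 <= p) (q0 : 0 <= q) (pq1 : p + q = 1).
Hypotheses (a0 : 0 <= a) (b0 : 0 <= b).
Hypotheses (pa : p <= a * expR l1) (qb : q <= b * expR l2).
Hypothesis ab1 : a + b - (a - b) / D + `|(a - b) / D| <= 1.

(* rho is a mixture, with weights P, of states r s, where s records which of
   the symmetric and antisymmetric channels acted in each round; the weights A
   turn the mixture into an operator whose partial transpose has trace norm at
   most 1, and L is the log-likelihood ratio. *)
Definition decomposed (n : nat) (A B : finType) (rho : op R (A * B)%type) :=
  exists (S : finType) (P W L : S -> R) (r : S -> op R (A * B)%type),
  [/\ [/\ forall s, 0 <= P s, \sum_s P s = 1,
         \sum_s P s * (L s - n%:R * f) = 0 &
         \sum_s P s * (L s - n%:R * f) ^+ 2 = n%:R * v],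
      forall s, 0 <= W s /\ P s <= W s * expR (L s),
      forall s, psd (r s) /\ \tr (r s) = 1,
      rho = \sum_s (P s)%:C *: r s &
      exists Z : op R (A * B)%type,
      [/\ psd (Z + ptranspose (\sum_s (W s)%:C *: r s)),
          psd (Z - ptranspose (\sum_s (W s)%:C *: r s)) & \tr Z <= 1]].

Lemma decomposed_ppt_map n (A B A' B' : finType)
    (L : op R (A * B)%type -> op R (A' * B')%type) rho :
  ppt_map L -> decomposed n rho -> decomposed n (L rho).
Proof.
move=> LP [S [P [W [l [r [Pl PW rs -> [Z [Zp Zm Z1]]]]]]]].
exists S, P, W, l, (fun s => L (r s)); split => //.
- move=> s; have [rp r1] := rs s; split; first exact: (ppt_psd LP).
  by rewrite (ppt_trace LP).
- exact: ppt_map_lincomb.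
(* The majorant is carried along by the conjugate of [L] under partial transposition, which is
   positive and preserves the trace. *)
exists (ptranspose (L (ptranspose Z))); rewrite -(ppt_map_lincomb LP).
set X := \sum_s _ in Zp Zm *; split.
- rewrite -ptransposeD -(ppt_mapD LP); apply: (ppt_ptranspose LP).
  by rewrite ptransposeD ptransposeK.
- rewrite -ptransposeN -ptransposeD -scaleN1r -(ppt_mapZ LP) scaleN1r.
  rewrite -(ppt_mapD LP); apply: (ppt_ptranspose LP).
  by rewrite ptransposeD ptransposeN ptransposeK.
- by rewrite tr_ptranspose (ppt_trace LP) tr_ptranspose.
Qed.

Lemma decomposed1 : decomposed 0 (1%:M : op R (unit * unit)%type).
Proof.
have t1 : \tr (1%:M : op R (unit * unit)%type) = 1.
  by rewrite mxtrace1 card_prod card_unit.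
have p1 : psd (1%:M : op R (unit * unit)%type).
  move=> u; rewrite mulmx1 mxE sumr_ge0 // => i _.
  by rewrite !mxE mul_conjC_ge0.
exists unit, (fun=> 1), (fun=> 1), (fun=> 0), (fun=> 1%:M).
rewrite !big_const !card_unit /= !addr0 scale1r ptranspose_scalar; split.
- by rewrite !mul0r subrr expr0n mulr0.
- by rewrite expR0 mulr1.
- by [].
- by [].
exists 1%:M; rewrite t1 subrr; split; [exact: psdD|exact: psd0|by []].
Qed.

(** [true] stands for the symmetric channel and [false] for the antisymmetric one; the scalars make
    both preserve the trace. *)
Definition sgn_channel (c : bool) : op R 'I_d -> op R 'I_d :=
  if c then @twchan R 'I_d (D + 1)^-1 (D + 1)^-1
  else @twchan R 'I_d (D - 1)^-1 (- (D - 1)^-1).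

Let D2 : 2 <= D. Proof. by rewrite (ler_nat R 2). Qed.
Let D0 : 0 < D. Proof. by move: D2; move: D => x; lra. Qed.
Let Dp : 0 < D + 1. Proof. by move: D2; move: D => x; lra. Qed.
Let Dm : 0 < D - 1. Proof. by move: D2; move: D => x; lra. Qed.

Lemma transmit_twchanZ (T A B : finType) (u w x : R) (X : op R ((A * T) * B)%type) :
  transmit (@twchan R T (x * u) (x * w)) X = x%:C *: transmit (@twchan R T u w) X.
Proof.
have := @transmit_twchan_comb R T A B x 0 u w 0 0 X.
by rewrite !mul0r !addr0 scale0r addr0 => ->.
Qed.

Lemma psd_sgn_channel c (A B : finType) (X : op R ((A * 'I_d) * B)%type) :
  psd X -> psd (transmit (sgn_channel c) X).
Proof.
move=> Xp; rewrite /sgn_channel; case: c.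
  rewrite -[(D + 1)^-1]mulr1 transmit_twchanZ; apply: psdZ.
    by rewrite invr_ge0 ltW.
  by apply: psd_transmit_twchan; rewrite ?expr1n.
have := @transmit_twchanZ 'I_d A B 1 (-1) (D - 1)^-1 X.
rewrite mulr1 mulrN1 => ->; apply: psdZ.
  by rewrite invr_ge0 ltW.
by apply: psd_transmit_twchan; rewrite ?sqrrN ?expr1n.
Qed.

Lemma tr_sgn_channel c (A B : finType) (X : op R ((A * 'I_d) * B)%type) :
  \tr (transmit (sgn_channel c) X) = \tr X.
Proof.
rewrite /sgn_channel; case: c; rewrite tr_transmit_twchan card_ord.
  by rewrite (_ : _ + _ = 1) ?mul1r //; field; rewrite gt_eqF.
by rewrite (_ : _ + _ = 1) ?mul1r //; field; rewrite gt_eqF.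
Qed.

Lemma transmit_sgn_comb x y (A B : finType) (X : op R ((A * 'I_d) * B)%type) :
  transmit (@twchan R 'I_d (x / (D + 1) + y / (D - 1))
    (x / (D + 1) - y / (D - 1))) X =
  x%:C *: transmit (sgn_channel true) X + y%:C *: transmit (sgn_channel false) X.
Proof. by rewrite -transmit_twchan_comb mulrN. Qed.

Local Notation hw := (@twchan R 'I_d (p / (D + 1) + q / (D - 1))
    (p / (D + 1) - q / (D - 1))).

Lemma transmit_sgn_lincomb c (A B I : finType) (k : I -> C)
    (X : I -> op R ((A * 'I_d) * B)%type) :
  transmit (sgn_channel c) (\sum_i k i *: X i) =
  \sum_i k i *: transmit (sgn_channel c) (X i).
Proof.
have lin x Y Y' : transmit (sgn_channel c) (x *: Y + Y') =
    x *: transmit (sgn_channel c) Y + transmit (sgn_channel c) Y' :> op R (A * ('I_d * B))%type.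
  by rewrite /sgn_channel; case: c; rewrite transmit_twchanD.
have t0 : transmit (sgn_channel c) 0 = 0 :> op R (A * ('I_d * B))%type.
  by have := lin (-1) 0 0; rewrite !scaleN1r oppr0 addr0 addNr.
apply: (big_ind2 (fun u w => transmit (sgn_channel c) u = w)) =>
    [|x x' y y' <- <-|i _]; first exact: t0.
  by have := lin 1 x y; rewrite !scale1r.
by have := lin (k i) (X i) 0; rewrite t0 !addr0.
Qed.

Lemma transmit_weighted x y (A B S : finType) (k : S -> R)
    (r : S -> op R ((A * 'I_d) * B)%type) :
  transmit (@twchan R 'I_d (x / (D + 1) + y / (D - 1))
    (x / (D + 1) - y / (D - 1))) (\sum_s (k s)%:C *: r s) =
  \sum_(t : S * bool) (k t.1 * (if t.2 then x else y))%:C *: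
    transmit (sgn_channel t.2) (r t.1).
Proof.
rewrite transmit_sgn_comb 2!transmit_sgn_lincomb.
rewrite -(pair_bigA _ (fun s c => (k s * (if c then x else y))%:C *:
    transmit (sgn_channel c) (r s))) /= !scaler_sumr -big_split.
apply: eq_bigr => s _; rewrite big_bool /= 2!scalerA -!rmorphM.
by rewrite [x * _]mulrC [y * _]mulrC.
Qed.

(** Needed for the coefficient [(a - b) / D], which may have either sign. *)
Lemma psd_signed n (x : R) (X Y : 'M[C]_n) :
  psd (X + Y) -> psd (X - Y) -> psd (`|x|%:C *: X + x%:C *: Y).
Proof.
move=> Xp Xm; have [x0|x0] := leP 0 x.
  by rewrite (ger0_norm x0) -scalerDr; exact: (psdZ x0 Xp).
rewrite (ltr0_norm x0) (_ : _ + _ = (- x)%:C *: (X - Y)).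
  by apply: (psdZ _ Xm); rewrite oppr_ge0 ltW.
by rewrite scalerBr rmorphN !scaleNr opprK.
Qed.

Lemma sum_bool_prod (S : finType) (F : S -> bool -> R) :
  \sum_(t : S * bool) F t.1 t.2 = \sum_s (F s true + F s false).
Proof.
by rewrite -(pair_bigA _ F) /=; apply: eq_bigr => s _; rewrite big_bool.
Qed.

(** Each string gains an independent letter, so weights multiply and log-ratios add. On the
    partially transposed side the weighted channel is a combination of two completely positive maps,
    through which the majorant [Z] is propagated. *)
Lemma decomposed_transmit n (A B : finType) (rho : op R ((A * 'I_d) * B)%type) :
  decomposed n rho -> decomposed n.+1 (transmit hw rho).
Proof.
move=> [S [P [W [l [r [[P0 P1 Pm Pv] PW rs -> [Z [Zp Zm Z1]]]]]]]].
exists (S * bool)%type, (fun t => P t.1 * (if t.2 then p else q)),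
  (fun t => W t.1 * (if t.2 then a else b)),
  (fun t => l t.1 + (if t.2 then l1 else l2)),
  (fun t => transmit (sgn_channel t.2) (r t.1)).
split.
- split.
  + by case=> s [] /=; rewrite mulr_ge0.
  + rewrite (sum_bool_prod (fun s c => P s * (if c then p else q))) /=.
    by under eq_bigr do rewrite -mulrDr pq1 mulr1.
  + rewrite (sum_bool_prod (fun s c => P s * (if c then p else q) *
      (l s + (if c then l1 else l2) - n.+1%:R * f))) /=.
    transitivity (\sum_s P s * (l s - n%:R * f)); last exact: Pm.
    apply: eq_bigr => s _; rewrite -[n.+1]addn1 natrD.
    rewrite (_ : q = 1 - p); last by rewrite -pq1 addrC addKr.
    ring.
  (* The new letter has mean [f], so the cross term vanishes and the variance increases by [v]. *)
  + rewrite (sum_bool_prod (fun s c => P s * (if c then p else q) *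
      (l s + (if c then l1 else l2) - n.+1%:R * f) ^+ 2)) /=.
    transitivity (\sum_s (P s * (l s - n%:R * f) ^+ 2 + P s * v)).
      apply: eq_bigr => s _; rewrite -[n.+1]addn1 natrD.
      rewrite (_ : q = 1 - p); last by rewrite -pq1 addrC addKr.
      ring.
    by rewrite big_split /= Pv -mulr_suml P1 mul1r -[n.+1]addn1 natrD mulrDl mul1r.
- case=> s c /=; have [W0 WP] := PW s.
  split; first by case: c; rewrite mulr_ge0.
  rewrite expRD mulrACA; apply: ler_pM => //; by case: c.
- case=> s c /=; have [rp r1] := rs s; split; first exact: psd_sgn_channel.
  by rewrite tr_sgn_channel.
- exact: transmit_weighted.
rewrite -transmit_weighted ptranspose_transmit.
set Y := ptranspose _ in Zp Zm *.
set u := a / (D + 1) + b / (D - 1); set w := (a - b) / D.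
have u0 : 0 <= u by rewrite addr_ge0 // divr_ge0 // ltW.
(* The coefficient of the identity map is split as [- u / D + w]: the part [- u / D] is what
   complete positivity of the depolarizing map requires, and only [w] can be negative. *)
have dec X : transmit (@isochan R 'I_d u (a / (D + 1) - b / (D - 1))) X =
    u%:C *: transmit (@isochan R 'I_d 1 (- D^-1)) X +
    w%:C *: (transmit (@isochan R 'I_d 0 1) X : op R (A * ('I_d * B))%type).
  rewrite -transmit_isochan_comb; congr (transmit (isochan _ _)).
    by rewrite mulr1 mulr0 addr0.
  by rewrite /u /w; field; rewrite !gt_eqF.
have idp (X : op R ((A * 'I_d) * B)%type) : psd X ->
    psd (transmit (@isochan R 'I_d 0 1) X).
  apply: (@psd_transmit R 'I_d 'I_d A B unit _ (fun=> 1%:M)) => rho'.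
  rewrite big_const card_unit /= addr0 mul1mx adj1 mulmx1.
  by rewrite /isochan scale0r add0r scale1r.
have depp (X : op R ((A * 'I_d) * B)%type) : psd X ->
    psd (transmit (@isochan R 'I_d 1 (- D^-1)) X).
  have := @psd_transmit_isochan R 'I_d A B X; rewrite card_ord; apply.
  exact: ltn_trans d2.
(* The same two maps are applied to [Z], with [|w|] in place of [w]. *)
pose Z' := u%:C *: transmit (@isochan R 'I_d 1 (- D^-1)) Z +
  `|w|%:C *: (transmit (@isochan R 'I_d 0 1) Z : op R (A * ('I_d * B))%type).
have lin u' w' c X X' := @transmit_isochanD R 'I_d A B u' w' c X X'.
have linD u' w' X X' : transmit (@isochan R 'I_d u' w') (X + X') =
    transmit (@isochan R 'I_d u' w') X +
    (transmit (@isochan R 'I_d u' w') X' : op R (A * ('I_d * B))%type).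
  by have := lin u' w' 1 X X'; rewrite !scale1r.
have linB u' w' X X' : transmit (@isochan R 'I_d u' w') (X - X') =
    transmit (@isochan R 'I_d u' w') X -
    (transmit (@isochan R 'I_d u' w') X' : op R (A * ('I_d * B))%type).
  by have := lin u' w' (-1) X' X; rewrite !scaleN1r addrC => ->; rewrite addrC.
exists Z'; rewrite dec /Z'; split.
- rewrite addrACA; apply: psdD.
    by rewrite -scalerDr -linD; apply: (psdZ u0); exact: depp.
  by apply: psd_signed; [rewrite -linD|rewrite -linB]; exact: idp.
- rewrite opprD addrACA; apply: psdD.
    by rewrite -scalerBr -linB; apply: (psdZ u0); exact: depp.
  rewrite -scalerN; apply: psd_signed; last rewrite opprK.
    by rewrite -linB; exact: idp.
  by rewrite -linD; exact: idp.
have tZ : 0 <= \tr Z.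
  have := addr_ge0 (psd_tr_ge0 Zp) (psd_tr_ge0 Zm).
  rewrite !mxtraceD raddfN addrACA subrr addr0 -mulr2n.
  by rewrite (pmulrn_lge0 _ (isT : (0 < 2)%N)).
rewrite mxtrace_lincomb.
have -> : \tr (transmit (@isochan R 'I_d 1 (- D^-1)) Z) = (D - D^-1)%:C * \tr Z.
  by rewrite tr_transmit_isochan card_ord mul1r.
have -> : \tr (transmit (@isochan R 'I_d 0 1) Z) = \tr Z.
  by rewrite tr_transmit_isochan mul0r add0r mul1r.
rewrite mulrA -mulrDl -rmorphM -rmorphD.
apply: le_trans Z1; apply: ler_piMl => //; rewrite -(rmorph1 (real_complex R)) lecR.
(* The trace is multiplied by [u (D - D^-1) + |w|], which is the left side of [ab1]. *)
apply: le_trans ab1; rewrite -/w lerD2r le_eqVlt; apply/orP; left; apply/eqP.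
by rewrite /u /w; field; rewrite !gt_eqF.
Qed.

Lemma adaptive_decomposed n (A B : finType) (rho : op R (A * B)%type) :
  adaptive hw n rho -> decomposed n rho.
Proof.
elim=> {n A B rho} [A B L /LOCC_ppt_map LP|n A B A' B' rho L _ ih].
  exact/(decomposed_ppt_map LP)/decomposed1.
by move=> /LOCC_ppt_map LP; apply/(decomposed_ppt_map LP)/decomposed_transmit.
Qed.

(** Where [L s <= n (f + delta)], [P s] is at most [expR (n (f + delta))] times [W s], and the
    [W]-weighted overlap is at most [k]. The other strings have overlap at most 1 and are charged to
    the variance by Chebyshev's inequality. Both cases are merged in the termwise estimate [key]. *)
Lemma decomposed_overlap n (A B : finType) (rho Phi : op R (A * B)%type)
    (k delta : R) : (0 < n)%N -> 0 < delta ->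
  (forall X, psd X -> 0 <= \tr (Phi *m X) <= \tr X) ->
  (forall X Z, psd (Z + ptranspose X) -> psd (Z - ptranspose X) ->
    \tr Z <= 1 -> complex.Re (\tr (Phi *m X)) <= k) ->
  decomposed n rho ->
  complex.Re (\tr (Phi *m rho)) <=
    expR (n%:R * (f + delta)) * k + v / (n%:R * delta ^+ 2).
Proof.
move=> n0 dlt Phi01 Phik.
move=> [S [P [W [l [r [[P0 P1 Pm Pv] PW rs -> [Z [Zp Zm Z1]]]]]]]].
have Re_comb (c : S -> R) : complex.Re (\tr (Phi *m (\sum_s (c s)%:C *: r s))) =
    \sum_s c s * complex.Re (\tr (Phi *m r s)).
  exact: Re_trM_lincomb.
have := Phik _ _ Zp Zm Z1; rewrite !Re_comb.
set t := fun s => complex.Re (\tr (Phi *m r s)).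
have t01 s : 0 <= t s <= 1.
  have [rp r1] := rs s; have := Phi01 _ rp; rewrite r1 => /andP[h0 h1].
  by apply/andP; split; [have := Re_le h0 | have := Re_le h1].
move=> Wk; rewrite -/(t _).
have nd : 0 < n%:R * delta by rewrite mulr_gt0 // ltr0n.
pose E := expR (n%:R * (f + delta)).
have key s : P s * t s <=
    E * (W s * t s) + P s * (l s - n%:R * f) ^+ 2 / (n%:R * delta) ^+ 2.
  have [W0 PWs] := PW s; have /andP[t0 t1] := t01 s.
  have [ls|ls] := leP (l s) (n%:R * (f + delta)).
    rewrite -[leLHS]addr0; apply: lerD.
      rewrite mulrA ler_wpM2r // mulrC (le_trans PWs) // ler_wpM2l //.
      by rewrite ler_expR.
    exact: (divr_ge0 (mulr_ge0 (P0 s) (sqr_ge0 _)) (sqr_ge0 _)).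
  rewrite -[leLHS]add0r; apply: lerD.
    by rewrite !mulr_ge0 ?expR_ge0.
  rewrite -mulrA ler_wpM2l //; apply: (le_trans t1).
  have h : n%:R * delta < l s - n%:R * f by rewrite ltrBrDl -mulrDr.
  have h0 : 0 < l s - n%:R * f := lt_trans nd h.
  rewrite ler_pdivlMr ?exprn_gt0 // mul1r.
  by rewrite ler_pXn2r ?nnegrE ?(ltW nd) ?(ltW h0) ?(ltW h).
apply: (le_trans (ler_sum _ (fun s _ => key s))).
rewrite big_split /= -mulr_sumr -mulr_suml Pv; apply: lerD.
  by rewrite ler_wpM2l ?expR_ge0.
rewrite le_eqVlt; apply/orP; left; apply/eqP; rewrite exprMn expr2.
by field; rewrite !gt_eqF ?ltr0n.
Qed.

End AdaptiveProtocols.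

(** * The two-way capacity *)

Section Distillation.
Local Open Scope sesquilinear_scope.
Variable R : realType.
Local Notation C := R[i].
Local Notation "x %:C" := (real_complex R x) : ring_scope.

Lemma ebit_overlap m (X : op R ({ffun 'I_m -> 'I_2} * {ffun 'I_m -> 'I_2})%type) :
  psd X -> 0 <= \tr (bipow m (ebit R) *m X) <= \tr X.
Proof.
have [U [e [UU -> e01 _]]] := bipow_ebit_opdiag R m => Xp.
rewrite psd_tr_opdiagM //=; last by move=> t; case: (e01 t) => ->.
rewrite -subr_ge0 -[X in \tr X - _]mul1mx -raddfB -mulmxBl /=.
rewrite -(rmorph1 (real_complex R)) -(opdiag_cst UU) -scaleN1r.
rewrite -(rmorph1 (real_complex R)) -rmorphN -opdiagZ -opdiagD.
apply: psd_tr_opdiagM => // t; case: (e01 t) => ->; by rewrite mulN1r ?subrr ?oppr0 ?addr0.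
Qed.

(** Both factors are partially transposed: the transposed ebits have operator norm at most [2^-m],
    and the transposed [X] is dominated by [Z]. *)
Lemma ebit_overlap_pt m
    (X Z : op R ({ffun 'I_m -> 'I_2} * {ffun 'I_m -> 'I_2})%type) :
  psd (Z + ptranspose X) -> psd (Z - ptranspose X) -> \tr Z <= 1 ->
  complex.Re (\tr (bipow m (ebit R) *m X)) <= 2^-1 ^+ m.
Proof.
move=> Zp Zm Z1; rewrite -tr_ptransposeM.
have [U [e [UU -> ek]]] := ptranspose_ebit_opdiag R m.
apply: le_trans (tr_opdiagM_bound UU ek Zp Zm) _.
by apply: ler_piMr; [rewrite exprn_ge0|have := Re_le Z1].
Qed.

Lemma psd_ebit m : psd (bipow m (ebit R)) /\ psd (1%:M - bipow m (ebit R)).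
Proof.
have [U [e [UU -> e01 _]]] := bipow_ebit_opdiag R m; split.
  by apply: psd_opdiag => t; case: (e01 t) => ->.
rewrite -(rmorph1 (real_complex R)) -(opdiag_cst UU) -scaleN1r.
rewrite -(rmorph1 (real_complex R)) -rmorphN -opdiagZ -opdiagD.
apply: psd_opdiag => t; case: (e01 t) => ->; by rewrite mulN1r ?subrr ?oppr0 ?addr0.
Qed.

(** The ebits form a projector [Phi] with [Tr Phi Phi = 1], and testing [rho - Phi] against it loses
    at most the trace norm. *)
Lemma fidelity_ge m (rho : op R ({ffun 'I_m -> 'I_2} * {ffun 'I_m -> 'I_2})%type) eps :
  psd rho -> trace_norm (rho - bipow m (ebit R)) <= eps ->
  1 - eps <= complex.Re (\tr (bipow m (ebit R) *m rho)).
Proof.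
move=> rp te; set Phi := bipow m (ebit R) in te *.
have [P0 P1] := psd_ebit m.
have hX : (rho - Phi)^t* = rho - Phi.
  by rewrite -scaleN1r adjD adjZ (psd_herm rp) (psd_herm P0) rmorphN1.
have := tr_norm_bound P0 P1 hX; rewrite -/Phi mulmxBr raddfB /= ReD ReN.
have -> : \tr (Phi *m Phi) = 1.
  rewrite /Phi; have [U [e [UU -> e01 se]]] := bipow_ebit_opdiag R m.
  rewrite (opdiagM UU) (tr_opdiag UU) -(rmorph1 (real_complex R)) -se.
  by congr (_ %:C); apply: eq_bigr => t _; case: (e01 t) => ->; rewrite ?mulr0 ?mulr1.
rewrite /= lerBrDr => h; apply: le_trans h.
by rewrite addrC lerD2r lerN2.
Qed.

(** * From finitely many uses to the asymptotic rate *)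

Section Rate.
Variables (d : nat) (p q a b l1 l2 : R).
Local Notation D := (d%:R : R).
Local Notation f := (p * l1 + q * l2).
Local Notation v := (p * (l1 - f) ^+ 2 + q * (l2 - f) ^+ 2).
Hypothesis d2 : (2 <= d)%N.
Hypotheses (p0 : 0 <= p) (q0 : 0 <= q) (pq1 : p + q = 1).
Hypotheses (a0 : 0 <= a) (b0 : 0 <= b).
Hypotheses (pa : p <= a * expR l1) (qb : q <= b * expR l2).
Hypothesis ab1 : a + b - (a - b) / D + `|(a - b) / D| <= 1.
Local Notation hw := (@twchan R 'I_d (p / (D + 1) + q / (D - 1))
    (p / (D + 1) - q / (D - 1))).

Lemma decomposed_psd n (A B : finType) (rho : op R (A * B)%type) :
  decomposed p q l1 l2 n rho -> psd rho.
Proof.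
move=> [S [P [W [l [r [[P0 _ _ _] _ rs -> _]]]]]].
by apply: psd_sum => s; apply: psdZ (P0 s) _; case: (rs s).
Qed.

Lemma distributes_bound n m eps delta : (0 < n)%N -> 0 < delta ->
  distributes hw n m eps ->
  1 - eps <= expR (n%:R * (f + delta)) * 2^-1 ^+ m + v / (n%:R * delta ^+ 2).
Proof.
move=> n0 dlt [rho [/(adaptive_decomposed d2 p0 q0 pq1 a0 b0 pa qb ab1) rd te]].
apply: le_trans (fidelity_ge (decomposed_psd rd) te) _.
apply: (decomposed_overlap n0 dlt _ _ rd); first exact: ebit_overlap.
exact: ebit_overlap_pt.
Qed.

(** If [r ln 2] exceeded [f], both error terms would be of order [1 / n], while their sum is at
    least [1 - eps > 0] for all large [n]. *)
Lemma distributes_rate (m : nat -> nat) (eps r : R) : eps < 1 ->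
  (forall n, (0 < n)%N -> distributes hw n (m n) eps) ->
  (m n)%:R / n%:R @[n --> \oo] --> r -> r * ln 2 <= f.
Proof.
move=> e1 md mr; rewrite leNgt; apply/negP => fr.
(* A quarter of the gap: one part is lost to the convergence of [m n / n] and one to the deviation,
   which leaves an exponent of at most [- 2 n delta]. *)
pose delta := (r * ln 2 - f) / 4.
have dlt : 0 < delta by rewrite divr_gt0 // subr_gt0.
have ln2 : 0 < ln 2 :> R by rewrite ln_gt0 // ltr1n.
have m2 (k : nat) : 2^-1 ^+ k = expR (- (k%:R * ln 2)) :> R.
  rewrite expRN mulrC expRM_natr lnK ?posrE // exprVn //.
have v0 : 0 <= v by rewrite addr_ge0 // mulr_ge0 ?sqr_ge0.
pose c := delta^-1 + v / delta ^+ 2.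
have small n : (0 < n)%N -> r - delta / ln 2 < (m n)%:R / n%:R ->
    (1 - eps) * n%:R <= c.
  move=> n0 rm; have n0' : 0 < n%:R :> R by rewrite ltr0n.
  have rm' : n%:R * (f + 3 * delta) <= (m n)%:R * ln 2.
    rewrite mulrC -ler_pdivlMr // mulrAC; apply: le_trans (_ : (r - delta / ln 2) * ln 2 <= _).
      rewrite mulrBl divfK ?gt_eqF // /delta; lra.
    by rewrite ler_wpM2r // ltW.
  rewrite -ler_pdivlMr //; apply: le_trans (distributes_bound n0 dlt (md n n0)) _.
  have -> : c / n%:R = (delta * n%:R)^-1 + v / (n%:R * delta ^+ 2).
    by rewrite /c; field; rewrite !gt_eqF.
  rewrite lerD2r.
  rewrite m2 -expRD.
  apply: le_trans (_ : expR (- (delta * n%:R)) <= _).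
    rewrite ler_expR; have : 0 <= n%:R * delta by rewrite mulr_ge0 // ltW.
    move: rm'; rewrite !mulrDr; set x := n%:R * (p * l1); set y := n%:R * (q * l2).
    set z := n%:R * (3 * delta); have -> : z = 3 * (n%:R * delta) by rewrite /z; ring.
    rewrite [delta * _]mulrC; lra.
  have dn : 0 < delta * n%:R := mulr_gt0 dlt n0'.
  (* The exponential decay is weakened to [1 / (n delta)], so that both error terms have the form
     [c / n]. *)
  rewrite expRN lef_pV2 ?posrE ?expR_gt0 //.
  by apply: le_trans (expR_ge1Dx _); rewrite lerDr.
have [N _ hN] : \forall n \near \oo, r - delta / ln 2 < (m n)%:R / n%:R.
  by apply: (cvgr_gt _ mr); rewrite ltrBlDr ltrDl divr_gt0.
have e0 : 0 < 1 - eps by rewrite subr_gt0.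
(* Past the threshold [N] of convergence and strictly above [c / (1 - eps)], which contradicts
   [small]. *)
pose n := maxn N.+1 (Num.truncn (c / (1 - eps))).+1.
have n0 : (0 < n)%N by rewrite /n leq_max.
have nN : (N <= n)%N by rewrite /n leq_max leqW.
have := small n n0 (hN n nN); rewrite mulrC -ler_pdivlMr // leNgt.
have id0 : 0 <= delta^-1 by rewrite invr_ge0 ltW.
have c0 : 0 <= c := addr_ge0 id0 (divr_ge0 v0 (sqr_ge0 _)).
have /truncn_itv /andP[_ h] : 0 <= c / (1 - eps) := divr_ge0 c0 (ltW e0).
by rewrite (lt_le_trans h) // ler_nat /n leq_max leqnn orbT.
Qed.

Lemma Q2_twchan : (Q2 hw <= (f / ln 2)%:E)%E.
Proof.
have ln2 : 0 < ln 2 :> R by rewrite ln_gt0 // ltr1n.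
(* Monotonicity in [eps] makes the one-sided limit exist, so that the [lim] in [Q2] is a genuine
   limit. *)
have mono : {in `]0, 1[ &, nondecreasing_fun (Q2_eps hw)}.
  move=> x y _ _ xy; apply: le_ereal_sup => _ [r [m [md mr]] <-].
  exists r => //; exists m; split=> // n n0.
  by have [rho [ad te]] := md n n0; exists rho; split=> //; exact: le_trans xy.
have cv : cvg (Q2_eps hw eps @[eps --> (0 : R)^'+]).
  apply/cvg_ex; exists (ereal_inf (Q2_eps hw @` `]0, 1[%classic)).
  by apply: (nondecreasing_at_right_cvge (BLeft 1)); rewrite ?bnd_simp.
apply: lime_le => //; near=> eps.
apply: ge_ereal_sup => _ [r [m [md mr]] <-]; rewrite lee_fin ler_pdivlMr //.
apply: (distributes_rate _ md mr); near: eps; exact: nbhs_right_lt.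
Unshelve. all: by end_near. Qed.

End Rate.
End Distillation.

(** * Relative entropy *)

Section RelativeEntropy.
Local Open Scope sesquilinear_scope.
Variable R : realType.
Local Notation C := R[i].
Local Notation "x %:C" := (real_complex R x) : ring_scope.

(** The diagonal of one operator in the eigenbasis of another averages its eigenvalues with the
    squared moduli of the overlaps of the two bases. *)
Lemma diag_conj_udiag n (U S : 'M[C]_n) (l : 'I_n -> R) i :
  (U *m udiag S l *m U^t*) i i =
  (\sum_j complex.Re `|(U *m S^t*) i j| ^+ 2 * l j)%:C.
Proof.
have -> : U *m udiag S l *m U^t* =
    (U *m S^t*) *m diag_mx (\row_j (l j)%:C) *m (U *m S^t*)^t*.
  by rewrite adjM trmxCK /udiag /gdiag !mulmxA.
set W := U *m S^t*; rewrite mxE rmorph_sum; apply: eq_bigr => j _.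
have -> : (W^t*) j i = (W i j)^* by rewrite !mxE.
have -> : (W *m diag_mx (\row_j (l j)%:C)) i j = W i j * (l j)%:C.
  by rewrite mul_mx_diag !mxE.
by rewrite mulrAC -normCK rmorphM rmorphXn /=; congr (_ ^+ 2 * _).
Qed.

Lemma ln_le_subr1 (x : R) : 0 < x -> ln x <= x - 1.
Proof.
move=> x0; rewrite -ler_expR lnK ?posrE //.
by apply: le_trans (expR_ge1Dx _); rewrite addrC subrK.
Qed.

(** With [c i j] the squared overlaps of the two eigenbases, the claim becomes classical: apply
    [ln x <= x - 1] to [g i * l j / r i] for each pair. The resulting lower bound sums to
    [1 - Tr G sigma >= 0], where [G = udiag U g]. *)
Lemma rel_entropy_ge n (U : 'M[C]_n) (r g : 'I_n -> R) (sigma : 'M[C]_n) :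
  U \is unitarymx -> (forall i, 0 <= r i) -> \sum_i r i = 1 ->
  (forall i, 0 <= g i) -> (forall i, 0 < r i -> 0 < g i) -> psd sigma ->
  complex.Re (\tr (udiag U g *m sigma)) <= 1 ->
  (((\sum_i r i * ln (g i)) / ln 2)%:E <= rel_entropy (udiag U r) sigma)%E.
Proof.
move=> UU r0 r1 g0 rg sp tg; rewrite /rel_entropy.
case: ifP => [/submxP[M rM]|_]; last exact: leey.
rewrite lee_fin (herm_fun_udiag _ _ UU) (udiagM UU) raddfB /= ReD ReN (tr_udiag UU).
set S := spectralmx sigma; set l := fun i => complex.Re (spectral_diag sigma 0 i).
have SS : S \is unitarymx := spectral_unitarymx sigma.
have sE : sigma = udiag S l := herm_udiag (psd_herm sp).
set c := fun i j => complex.Re `|(U *m S^t*) i j| ^+ 2.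
have l0 j : 0 <= l j.
  have := psd_diag_ge0 j (psd_conj S sp); rewrite sE.
  have -> : S *m udiag S l *m S^t* = diag_mx (\row_i (l i)%:C).
    by rewrite /udiag /gdiag !mulmxA (unitarymxP SS) mul1mx (mulmxtVK _ SS).
  by rewrite !mxE eqxx mulr1n ler0c.
have c0 i j : 0 <= c i j by rewrite sqr_ge0.
have c1 i : \sum_j c i j = 1.
  have := diag_conj_udiag U S (fun=> 1) i.
  rewrite (udiag_cst SS) rmorph1 mulmx1 (unitarymxP UU) !mxE eqxx.
  move=> /esym /complexI h; rewrite -[RHS]h.
  by apply: eq_bigr => j _; rewrite mulr1.
(* The support condition [rho = M sigma] kills the overlaps of the support of [rho] with the kernel
   of [sigma]. This is where [ln 0 = 0] could otherwise falsify the estimate. *)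
have ker i j : l j = 0 -> r i * c i j = 0.
  move=> lj; suff h : r i = 0 \/ (U *m S^t*) i j = 0.
    by case: h => [->|h]; rewrite ?mul0r // /c h normr0 /= expr0n mulr0.
  have : U *m udiag U r *m S^t* = U *m M *m sigma *m S^t* by rewrite rM !mulmxA.
  rewrite sE; have -> : U *m udiag U r *m S^t* =
      diag_mx (\row_i (r i)%:C) *m (U *m S^t*).
    by rewrite /udiag /gdiag !mulmxA (unitarymxP UU) mul1mx.
  have -> : U *m M *m udiag S l *m S^t* =
      (U *m M *m S^t*) *m diag_mx (\row_i (l i)%:C).
    by rewrite /udiag /gdiag !mulmxA (mulmxtVK _ SS).
  set W := U *m S^t*; set Y := _ *m S^t*.
  rewrite mul_mx_diag mul_diag_mx => /matrixP/(_ i j); rewrite !mxE lj mulr0.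
  by move=> /eqP; rewrite mulf_eq0 => /orP[/eqP /complexI|/eqP]; auto.
have -> : complex.Re (\tr (udiag U r *m herm_fun (@log2 R) sigma)) =
    \sum_i \sum_j r i * (c i j * log2 (l j)).
  rewrite sE (herm_fun_udiag _ _ SS) tr_udiagM Re_sum; apply: eq_bigr => i _.
  by rewrite ReM_real diag_conj_udiag /= mulr_sumr.
have ln2 : 0 < ln 2 :> R by rewrite ln_gt0 // ltr1n.
rewrite ler_pdivrMr // mulrBl !mulr_suml lerBrDr.
have tg' : \sum_i \sum_j g i * (c i j * l j) <= 1.
  move: tg; rewrite sE tr_udiagM Re_sum; apply: le_trans.
  rewrite le_eqVlt; apply/orP; left; apply/eqP; apply: eq_bigr => i _.
  by rewrite ReM_real diag_conj_udiag /= mulr_sumr.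
rewrite -subr_ge0.
have -> : \sum_i r i * log2 (r i) * ln 2 - (\sum_i r i * ln (g i) +
    \sum_i (\sum_j r i * (c i j * log2 (l j))) * ln 2) =
    \sum_i \sum_j r i * c i j * (ln (r i) - ln (g i) - ln (l j)).
  rewrite -big_split /= -sumrB; apply: eq_bigr => i _.
  have e x : r i * x = \sum_j r i * c i j * x.
    by rewrite -mulr_suml -mulr_sumr c1 mulr1.
  rewrite /log2 mulrA divfK ?gt_eqF // (e (ln (r i))) (e (ln (g i))).
  rewrite mulr_suml -big_split /= -sumrB; apply: eq_bigr => j _.
  by field; rewrite gt_eqF.
suff : \sum_i \sum_j (r i * c i j - g i * (c i j * l j)) <=
    \sum_i \sum_j r i * c i j * (ln (r i) - ln (g i) - ln (l j)).
  apply: le_trans; under eq_bigr do rewrite sumrB -mulr_sumr c1 mulr1.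
  by rewrite sumrB r1 subr_ge0.
apply: ler_sum => i _; apply: ler_sum => j _.
have [ri|ri] := leP (r i) 0.
  have -> : r i = 0 by apply/eqP; rewrite eq_le ri r0.
  rewrite !mul0r sub0r oppr_le0.
  exact: (mulr_ge0 (g0 i) (mulr_ge0 (c0 i j) (l0 j))).
have [lj|lj] := leP (l j) 0.
  have lj0 : l j = 0 by apply/eqP; rewrite eq_le lj l0.
  by rewrite ker // mul0r lj0 !mulr0 subrr.
have gi := rg i ri.
have := ln_le_subr1 (divr_gt0 (mulr_gt0 gi lj) ri).
rewrite ln_div ?posrE ?mulr_gt0 // lnM ?posrE // => h.
rewrite -lerN2 opprB -mulrN.
have -> : g i * (c i j * l j) - r i * c i j =
    r i * c i j * (g i * l j / r i - 1) by field; rewrite gt_eqF.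
apply: ler_wpM2l; first by rewrite mulr_ge0.
by apply: le_trans h; rewrite le_eqVlt; apply/orP; left; apply/eqP; ring.
Qed.

Lemma rel_entropy_udiag n (U : 'M[C]_n) (r s : 'I_n -> R) :
  U \is unitarymx -> (forall i, s i = 0 -> r i = 0) ->
  rel_entropy (udiag U r) (udiag U s) =
  (\sum_i r i * (log2 (r i) - log2 (s i)))%:E.
Proof.
move=> UU sr; rewrite /rel_entropy.
have -> : (udiag U r <= udiag U s)%MS.
  have -> : udiag U r = udiag U (fun i => r i / s i) *m udiag U s.
    rewrite (udiagM UU); apply: eq_udiag => i.
    by have [/eqP/sr ->|si] := boolP (s i == 0); rewrite ?mul0r ?divfK.
  exact: submxMl.
have E f t : \tr (udiag U r *m herm_fun f (udiag U t)) =
    (\sum_i r i * f (t i))%:C.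
  by rewrite (herm_fun_udiag _ _ UU) (udiagM UU) (tr_udiag UU).
rewrite mxtraceB; congr (_ %:E).
have key (x y : C) (x' y' : R) : x = x'%:C -> y = y'%:C ->
    complex.Re (x - y) = x' - y' by move=> -> ->.
apply: etrans (key _ _ _ _ (E _ r) (E _ s)) _.
by rewrite -sumrB; apply: eq_bigr => i _; rewrite mulrBr.
Qed.

End RelativeEntropy.

(** * Expectations under product distributions *)

Section ProductExpectation.
Variables (R : realType) (A B : finType) (n : nat).
Local Notation AB := ({ffun 'I_n -> A} * {ffun 'I_n -> B})%type.

(** Linearity of expectation: inserting [phi] at coordinate [i] leaves a factor [\sum_t r t = 1] at
    every other coordinate. *)
Lemma sum_prod_additive (r phi : A * B -> R) : \sum_t r t = 1 ->
  \sum_(z : AB) (\prod_i r (z.1 i, z.2 i)) * (\sum_i phi (z.1 i, z.2 i)) =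
  n%:R * \sum_t r t * phi t.
Proof.
move=> r1; under eq_bigr do rewrite mulr_sumr.
rewrite exchange_big /= (eq_bigr (fun=> \sum_t r t * phi t)); last first.
  move=> i _.
  pose F j t := r t * (if j == i then phi t else 1).
  transitivity (\sum_(z : AB) \prod_j F j (z.1 j, z.2 j)).
    apply: eq_bigr => z _; rewrite /F big_split /=; congr (_ * _).
    by rewrite -big_mkcond /= big_pred1_eq.
  rewrite sum_prod_pair (bigD1 i) //= [X in _ * X]big1 ?mulr1.
    by apply: eq_bigr => t _; rewrite /F eqxx.
  move=> j ji; rewrite -[RHS]r1; apply: eq_bigr => t _.
  by rewrite /F (negbTE ji) mulr1.
by rewrite sumr_const card_ord mulr_natl.
Qed.

Lemma ln_prod (F : 'I_n -> R) : (forall i, 0 < F i) ->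
  ln (\prod_i F i) = \sum_i ln (F i).
Proof.
move=> F0; suff: 0 < \prod_i F i /\ ln (\prod_i F i) = \sum_i ln (F i) by case.
apply: (big_rec2 (fun x y => 0 < x /\ ln x = y)); first by rewrite ltr01 ln1.
by move=> i x y _ [x0 <-]; rewrite mulr_gt0 // lnM ?posrE.
Qed.

End ProductExpectation.

(** * Bounds for tensor powers of Werner states *)

Section WernerMajorant.
Variable R : realType.

(* The coefficients of a W_+ + b W_- on the identity (s = 1) and on the flip
   (s = -1) in dimension D. *)
Definition wx (D a b s : R) : R := a / (D * (D + 1)) + s * (b / (D * (D - 1))).

(* y0 + y1 F is the PPT state omega whose partial transpose dominates that of
   a W_+ + b W_-; the partial transpose of F has spectrum {0, D}. *)
Lemma werner_majorant (D a b : R) : 2 <= D -> 0 <= a -> 0 <= b ->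
  a + b - (a - b) / D + `|(a - b) / D| <= 1 ->
  exists y0 y1 : R, [/\ `|wx D a b 1| <= y0,
    `|wx D a b 1 + wx D a b (-1) * D| <= y0 + y1 * D,
    y0 * D ^+ 2 + y1 * D = 1 & `|y1| <= y0].
Proof.
move=> D2 a0 b0 ab1.
have D0 : 0 < D by lra.
have Dp : 0 < D + 1 by lra.
have Dm : 0 < D - 1 by lra.
have D21 : 0 < D ^+ 2 - 1.
  have -> : D ^+ 2 - 1 = (D - 1) * (D + 1) by ring.
  exact: mulr_gt0.
set w := (a - b) / D in ab1 *.
have ab : a + b <= 1 by have := ler_norm w; lra.
have xw : wx D a b 1 + wx D a b (-1) * D = w.
  by rewrite /wx /w; field; rewrite !gt_eqF.
have x0 : 0 <= wx D a b 1.
  by rewrite /wx mul1r addr_ge0 // divr_ge0 // ltW // mulr_gt0.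
(* Chosen so that the partial transpose of omega has eigenvalue [|w|] on the maximally entangled
   vector and [y0] on its complement, with total trace 1. *)
pose y0 := (1 - `|w|) / (D ^+ 2 - 1); pose y1 := (`|w| - y0) / D.
have y0E : y0 * (D ^+ 2 - 1) = 1 - `|w| by rewrite divfK ?gt_eqF.
have y1E : y1 * D = `|w| - y0 by rewrite divfK ?gt_eqF.
have x0y0 : wx D a b 1 <= y0.
  rewrite ler_pdivlMr //.
  have -> : wx D a b 1 * (D ^+ 2 - 1) = a + b - w.
    by rewrite /wx /w; field; rewrite !gt_eqF.
  lra.
have y00 := le_trans x0 x0y0.
(* This follows from [|a - b| <= a + b <= 1]; it is what makes omega itself positive. *)
have w1 : `|w| * D <= 1.
  rewrite -[D in _ * D](gtr0_norm D0) -normrM divfK ?gt_eqF // ler_norml.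
  by apply/andP; split; lra.
exists y0, y1; split.
- by rewrite ger0_norm.
- by rewrite xw y1E addrC subrK.
- have -> : y0 * D ^+ 2 + y1 * D = y0 * (D ^+ 2 - 1) + (y1 * D + y0) by ring.
  by rewrite y0E y1E; ring.
have y0D : y0 * (D + 1) = (1 - `|w|) / (D - 1).
  by rewrite /y0; field; rewrite !gt_eqF.
have w0 := normr_ge0 w.
have y0w : `|w| <= y0 * (D + 1).
  by rewrite y0D ler_pdivlMr // mulrBr mulr1; lra.
rewrite ler_norml; apply/andP; split.
  rewrite ler_pdivlMr //; have : y0 * 1 <= y0 * D by rewrite ler_wpM2l //; lra.
  rewrite mulNr; lra.
rewrite ler_pdivrMr //; move: y0w; rewrite mulrDr; lra.
Qed.

End WernerMajorant.

(** * Relative entropy of tensor powers to the PPT states *)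

Section WernerBounds.
Local Open Scope sesquilinear_scope.
Variable R : realType.
Local Notation C := R[i].
Local Notation "x %:C" := (real_complex R x) : ring_scope.
Variables (d : nat) (g a b : R).
Local Notation D := (d%:R : R).
Local Notation p := (a * (1 + g)).
Local Notation q := (b * (1 - g)).
Local Notation f := (p * ln (1 + g) + q * ln (1 - g)).
Hypothesis d2 : (2 <= d)%N.
Hypotheses (a0 : 0 <= a) (b0 : 0 <= b) (pq1 : p + q = 1).
Hypotheses (g0 : - (2 / D) <= g) (g1 : g <= 0).
Hypothesis ab1 : a + b - (a - b) / D + `|(a - b) / D| <= 1.

Let D2 : 2 <= D. Proof. by rewrite (ler_nat R 2). Qed.
Let D0 : 0 < D. Proof. exact: lt_le_trans D2. Qed.
Let D0' : D != 0. Proof. by rewrite gt_eqF. Qed.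
Let Dp : D + 1 != 0. Proof. by rewrite gt_eqF // addr_gt0. Qed.
Let Dm : D - 1 != 0.
Proof. by rewrite gt_eqF // subr_gt0 (lt_le_trans _ D2) // ltr1n. Qed.
Let g01 : 0 <= 1 + g.
Proof.
have h : 2 / D <= 1 by rewrite ler_pdivrMr // mul1r.
by rewrite -lerBlDl sub0r (le_trans _ g0) // lerN2.
Qed.
Let g02 : 0 < 1 - g.
Proof. by rewrite subr_gt0 (le_lt_trans g1). Qed.

Lemma ptranspose_lincomb (A B : finType) (c : C) (X Y X' Y' : op R (A * B)%type) :
  ptranspose X = X' -> ptranspose Y = Y' ->
  ptranspose (c *: (X + Y)) = c *: (X' + Y').
Proof. by move=> <- <-; rewrite ptransposeZ ptransposeD. Qed.

(** On {1, -1} any [psi] coincides with an affine function, so its sum depends only on the dimension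
    and on the trace of the flip. *)
Lemma sum_flip_eigen (T : finType) (e : T -> R) (psi : R -> R) :
  (forall t, e t = 1 \/ e t = -1) -> \sum_t e t = D -> #|T| = (d * d)%N ->
  \sum_t psi (e t) =
  psi 1 * (D * (D + 1) / 2) + psi (-1) * (D * (D - 1) / 2).
Proof.
move=> e1 se cT.
rewrite (eq_bigr (fun t => (psi 1 + psi (-1)) / 2 + e t * ((psi 1 - psi (-1)) / 2))).
  by rewrite big_split /= sumr_const cT -mulr_suml se -[_ *+ (d * d)]mulr_natl natrM; field.
by move=> t _; case: (e1 t) => ->; field.
Qed.

Section Spectrum.
Variables (U : op R ('I_d * 'I_d)%type) (e : 'I_d * 'I_d -> R).
Hypotheses (UU : U \is unitarymx) (fE : flip R d = opdiag U e).
Hypotheses (e1 : forall t, e t = 1 \/ e t = -1) (se : \sum_t e t = D).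

Let card_T : #|{: 'I_d * 'I_d}| = (d * d)%N.
Proof. by rewrite card_prod card_ord. Qed.

(** [x], [h] and [r] are the eigenvalues of [X = a W_+ + b W_-], of [G = 1 + g F] and of the Werner
    state, which is the product [X G]. *)
Let x t := wx D a b 1 + wx D a b (-1) * e t.
Let h t := 1 + g * e t.
Let r t := x t * h t.

Let x_ge0 t : 0 <= x t.
Proof.
have u1 : 0 <= a / (D * (D + 1)) by rewrite divr_ge0 // mulr_ge0 ?addr_ge0 // ltW.
have u2 : 0 <= b / (D * (D - 1)).
  by rewrite divr_ge0 // mulr_ge0 // ?subr_ge0 ?(ltW D0) // (le_trans _ D2) // ler1n.
rewrite /x /wx mul1r mulN1r; case: (e1 t) => ->; move: u1 u2.
  by set u := a / _; set v := b / _; lra.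
by set u := a / _; set v := b / _; lra.
Qed.

Let h_ge0 t : 0 <= h t.
Proof. by rewrite /h; case: (e1 t) => ->; rewrite ?mulr1 ?mulrN1 // ltW. Qed.

Let r_ge0 t : 0 <= r t. Proof. exact: mulr_ge0. Qed.

Let sum_r (phi : R -> R) :
  \sum_t r t * phi (h t) = p * phi (1 + g) + q * phi (1 - g).
Proof.
rewrite (sum_flip_eigen (fun s => (wx D a b 1 + wx D a b (-1) * s) *
  (1 + g * s) * phi (1 + g * s)) e1 se card_T).
by rewrite /wx !mulr1 !mulrN1; field; apply/and3P.
Qed.

Let r1 : \sum_t r t = 1.
Proof.
have := sum_r (fun=> 1); rewrite !mulr1 pq1 => <-.
by apply: eq_bigr => t _; rewrite mulr1.
Qed.

Lemma wernerE eta : p = (1 + eta) / 2 -> q = (1 - eta) / 2 ->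
  werner d eta = opdiag U r.
Proof.
move=> pE qE; rewrite (_ : opdiag U r = opdiag U (fun t =>
   (D - eta) / (D ^+ 3 - D) + (D * eta - 1) / (D ^+ 3 - D) * e t)).
  rewrite (opdiag_affine UU) -fE /werner.
  have sc : (d%:R ^+ 3 - d%:R)^-1 = ((D ^+ 3 - D)^-1)%:C.
    by rewrite fmorphV rmorphB rmorphXn /= !rmorph_nat.
  have s1 : d%:R - eta%:C = (D - eta)%:C :> C by rewrite rmorphB /= rmorph_nat.
  have s2 : d%:R * eta%:C - 1 = (D * eta - 1)%:C :> C.
    by rewrite rmorphB rmorphM /= rmorph_nat rmorph1.
  rewrite sc s1 s2 scalerDr scale_scalar_mx scalerA -!rmorphM.
  by rewrite [_^-1 * (D - eta)]mulrC [_^-1 * _]mulrC.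
congr opdiag; apply/funext => t; rewrite /r /x /h.
have DD : D ^+ 3 - D != 0.
  have -> : D ^+ 3 - D = D * (D + 1) * (D - 1) by ring.
  by rewrite !mulf_neq0.
have -> : (D - eta) / (D ^+ 3 - D) + (D * eta - 1) / (D ^+ 3 - D) * e t =
    ((D - eta) + (D * eta - 1) * e t) / (D ^+ 3 - D) by field.
case: (e1 t) => ->; rewrite ?mulr1 ?mulrN1.
  transitivity (2 * p / (D * (D + 1))).
    by rewrite /wx; field; apply/and3P.
  by rewrite pE; field; rewrite DD Dp D0'.
transitivity (2 * q / (D * (D - 1))).
  by rewrite /wx; field; apply/and3P.
by rewrite qE; field; rewrite DD Dm D0'.
Qed.

Section Power.
Variable n : nat.
Local Notation AB := ({ffun 'I_n -> 'I_d} * {ffun 'I_n -> 'I_d})%type.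
Let pw (c : 'I_d * 'I_d -> R) (z : AB) := \prod_i c (z.1 i, z.2 i).

Let pw_ge0 c z : (forall t, 0 <= c t) -> 0 <= pw c z.
Proof. by move=> c0; apply: prodr_ge0. Qed.

Let sum_pw c : \sum_z pw c z = (\sum_t c t) ^+ n.
Proof.
by rewrite (@sum_prod_pair _ _ _ _ (fun i t => c t)) prodr_const card_ord.
Qed.

Let r_h t : r t != 0 -> 0 < x t /\ 0 < h t.
Proof.
rewrite mulf_eq0 negb_or => /andP[x0 h0].
by rewrite !lt_neqAle ![0 == _]eq_sym x0 h0 x_ge0 h_ge0.
Qed.

Let pw_r z : pw r z != 0 -> forall i, r (z.1 i, z.2 i) != 0.
Proof. by move=> /prodf_neq0 h0 i; exact: h0. Qed.

Let pw_rE z : pw r z = pw x z * pw h z.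
Proof. by rewrite /pw -big_split. Qed.

Let sum_ln : \sum_z pw r z * ln (pw h z) = n%:R * f.
Proof.
rewrite -(sum_r (fun s => ln s)) -(@sum_prod_additive _ _ _ _ r _ r1).
apply: eq_bigr => z _; rewrite -[\prod_i _]/(pw r z).
(* Strings of weight 0 are discarded first; on the others every factor [h] is positive and the
   logarithm of the product splits. *)
have [/eqP ->|rz] := boolP (pw r z == 0); first by rewrite !mul0r.
congr (_ * _); apply: ln_prod => i.
by have [] := r_h (pw_r rz i).
Qed.

Let UUn := @bipow_unitary R _ _ n U UU.

Lemma ptranspose_flip_pow (V : op R ('I_d * 'I_d)%type) k (u0 u1 : R) :
  V \is unitarymx -> flip_pt R d = opdiag V k ->
  ptranspose (opdiag (bipow n U) (pw (fun t => u0 + u1 * e t))) =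
  opdiag (bipow n V) (pw (fun t => u0 + u1 * k t)).
Proof.
move=> VV kE; rewrite -bipow_opdiag ptranspose_bipow (opdiag_affine UU) -fE.
rewrite ptransposeD ptransposeZ ptranspose_scalar -/(flip_pt R d) kE.
by rewrite -(opdiag_affine VV) bipow_opdiag.
Qed.

Lemma rel_entropy_werner_ge (sigma : op R AB) : PPT sigma ->
  ((n%:R * f / ln 2)%:E <= rel_entropy (bipow n (opdiag U r)) sigma)%E.
Proof.
move=> [[sp s1] spt]; rewrite bipow_opdiag /opdiag.
have -> : n%:R * f = \sum_(i < #|{: AB}|)
    pw r (enum_val i) * ln (pw h (enum_val i)).
  by rewrite -sum_ln -(sum_enum_val (fun z => pw r z * ln (pw h z))).
apply: rel_entropy_ge => //.
- by move=> i; exact: pw_ge0.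
- by rewrite (sum_enum_val (pw r)) sum_pw r1 expr1n.
- by move=> i; exact: pw_ge0.
- move=> i ri; have rz : pw r (enum_val i) != 0 by rewrite gt_eqF.
  by apply: prodr_gt0 => j _; have [] := r_h (pw_r rz j).
rewrite -[udiag _ _]/(opdiag (bipow n U) (pw h)) -tr_ptransposeM.
have [V [k [VV kE k01 _]]] := flip_pt_opdiag R d.
rewrite (ptranspose_flip_pow 1 g VV kE).
have Vn := @bipow_unitary R _ _ n V VV.
(* Used with [Z = X] the partial transpose of [sigma], positive since [sigma] is PPT. The one-copy
   eigenvalues 1 and [1 + g D] lie in [-1, 1] because [- 2 / D <= g <= 0]. *)
apply: le_trans (tr_opdiagM_bound Vn (k := 1) _ _ _) _.
- move=> z; rewrite normr_prod; apply: prodr_ile1 => i _; rewrite normr_ge0 /=.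
  case: (k01 (z.1 i, z.2 i)) => ->; first by rewrite mulr0 addr0 normr1.
  rewrite ler_norml; apply/andP; split; last first.
    by rewrite gerDl mulr_le0_ge0 // ltW.
  rewrite -lerBlDl; apply: le_trans (_ : - (2 / D) * D <= _).
    by rewrite mulNr divfK // -opprD.
  by rewrite ler_wpM2r // ltW.
- exact: (psdD spt spt).
- by rewrite subrr; exact: psd0.
by rewrite tr_ptranspose s1 mul1r.
Qed.

Lemma rel_entropy_werner_le : exists2 sigma : op R AB, PPT sigma &
  (rel_entropy (bipow n (opdiag U r)) sigma <= (n%:R * f / ln 2 + 1)%:E)%E.
Proof.
have [y0 [y1 [xy0 xy1 ys yy]]] := werner_majorant D2 a0 b0 ab1.
pose y t := y0 + y1 * e t.
have y_ge0 t : 0 <= y t.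
  by move: yy; rewrite /y ler_norml => /andP[h1 h2]; case: (e1 t) => ->;
    move: h1 h2; lra.
have sy : \sum_t y t = 1.
  rewrite big_split /= sumr_const card_T -mulr_sumr se.
  apply: etrans ys; by rewrite -[_ *+ (d * d)]mulr_natr natrM -expr2.
have sx : \sum_t x t = a + b.
  rewrite (sum_flip_eigen (fun s => wx D a b 1 + wx D a b (-1) * s) e1 se card_T).
  by rewrite /wx; field; apply/and3P.
have ab : a + b <= 1 by have := ab1; have := ler_norm ((a - b) / D); lra.
(* The trace of the sum of the tensor powers of omega and [X]. *)
pose c := 1 + (a + b) ^+ n.
have c1 : 1 <= c by rewrite lerDl exprn_ge0 // addr_ge0.
have c2 : c <= 2 by rewrite /c lerD2l exprn_ile1 // addr_ge0.
have c0 : 0 < c by exact: lt_le_trans c1.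
pose s z := c^-1 * (pw y z + pw x z).
have s_ge0 z : 0 <= s z.
  by apply: mulr_ge0; [rewrite invr_ge0 ltW|apply: addr_ge0; exact: pw_ge0].
(* Since [c <= 2], the ratio of [r] to [s] is at most [2 h]: the normalisation costs at most one
   bit, whatever [n] is. *)
have xs z : pw x z / 2 <= s z.
  rewrite /s mulrC; apply: ler_pM; rewrite ?invr_ge0 //; first exact: pw_ge0.
    by rewrite lef_pV2 ?posrE.
  by rewrite lerDr; exact: pw_ge0.
exists (opdiag (bipow n U) s).
  split; first split.
  - exact: psd_opdiag.
  - rewrite (tr_opdiag UUn) -mulr_sumr big_split /= !sum_pw sy sx expr1n.
    by rewrite mulVf ?gt_eqF // rmorph1.
  have [V [k [VV kE k01 _]]] := flip_pt_opdiag R d.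
  have YE := ptranspose_flip_pow y0 y1 VV kE.
  have XE := ptranspose_flip_pow (wx D a b 1) (wx D a b (-1)) VV kE.
  rewrite opdiagZ opdiagD (ptranspose_lincomb _ YE XE).
  rewrite -(opdiagD (bipow n V)).
  apply: psdZ; first by rewrite invr_ge0 ltW.
  apply: psd_opdiag => z; rewrite -lerBlDr sub0r.
  (* On the partially transposed side, in a common eigenbasis, each eigenvalue of [X] is bounded in
     modulus by that of omega, and products along strings inherit this. *)
  apply: le_trans (_ : `|\prod_i (wx D a b 1 + wx D a b (-1) * k (z.1 i, z.2 i))| <= _).
    by rewrite -normrN ler_norm.
  rewrite normr_prod; apply: ler_prod => i _; rewrite normr_ge0 /=.
  by case: (k01 (z.1 i, z.2 i)) => ->; rewrite ?mulr0 ?addr0.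
rewrite bipow_opdiag /opdiag (rel_entropy_udiag UUn); last first.
  move=> i si; apply/eqP; rewrite -[_ == 0]/(pw r (enum_val i) == 0) pw_rE.
  have : pw x (enum_val i) / 2 <= 0 by rewrite -si.
  rewrite pmulr_lle0 ?invr_gt0 // => x0.
  have -> : pw x (enum_val i) = 0 by apply/eqP; rewrite eq_le x0 pw_ge0.
  by rewrite mul0r.
rewrite lee_fin.
rewrite (sum_enum_val (fun z => pw r z * (log2 (pw r z) - log2 (s z)))).
have ln2 : 0 < ln 2 :> R by rewrite ln_gt0 // ltr1n.
have -> : n%:R * f / ln 2 + 1 = \sum_z pw r z * (ln (pw h z) / ln 2 + 1).
  under [RHS]eq_bigr do rewrite mulrDr mulr1 mulrA.
  by rewrite big_split /= -mulr_suml sum_ln sum_pw r1 expr1n.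
apply: ler_sum => z _.
have [/eqP ->|rz] := boolP (pw r z == 0); first by rewrite !mul0r.
apply: ler_wpM2l; first exact: pw_ge0.
have xz : 0 < pw x z by apply: prodr_gt0 => i _; have [] := r_h (pw_r rz i).
have hz : 0 < pw h z by apply: prodr_gt0 => i _; have [] := r_h (pw_r rz i).
have sz : 0 < s z by apply: lt_le_trans (xs z); rewrite divr_gt0.
rewrite /log2 -mulrBl ler_pdivrMr // mulrDl mul1r divfK ?gt_eqF //.
rewrite pw_rE lnM ?posrE // [ln (pw x z) + _]addrC -addrA lerD2l.
have s2 : 0 < 2 * s z := mulr_gt0 (ltr0Sn R 1) sz.
rewrite lerBlDr -lnM ?posrE // ler_ln ?posrE //.
by rewrite mulrC -ler_pdivrMr.
Qed.

Lemma EP_werner_bounds :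
  ((n%:R * f / ln 2)%:E <= EP (bipow n (opdiag U r)) <=
   (n%:R * f / ln 2 + 1)%:E)%E.
Proof.
apply/andP; split.
  by apply: le_ereal_inf_tmp => _ [sigma sP <-]; exact: rel_entropy_werner_ge.
have [sigma sP] := rel_entropy_werner_le.
by apply: le_trans; apply: ereal_inf_lbound; exists sigma.
Qed.

End Power.
End Spectrum.

End WernerBounds.

(** * The three regimes *)

Section MainBounds.
Local Open Scope sesquilinear_scope.
Variable R : realType.
Local Notation C := R[i].
Local Notation "x %:C" := (real_complex R x) : ring_scope.

(** Convergence is part of the package, so that [EP_inf] is a genuine limit. *)
Definition werner_bound (d : nat) (eta : R) (F : R) : Prop :=
  [/\ cvg (EP_rate (werner d eta) n @[n --> \oo]),
      (Q2 (@HW_channel R d eta) <= EP_inf (werner d eta))%E &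
      EP_inf (werner d eta) = F%:E].

(** As [eta] is the expectation of the flip in the Werner state, [p] and [q] are the weights of the
    symmetric and antisymmetric subspaces. *)
Lemma HW_channelE (d : nat) (eta : R) : (2 <= d)%N ->
  let p := (1 + eta) / 2 in let q := (1 - eta) / 2 in
  @HW_channel R d eta = @twchan R 'I_d
    (p / (d%:R + 1) + q / (d%:R - 1)) (p / (d%:R + 1) - q / (d%:R - 1)).
Proof.
move=> d2 p q; set D := d%:R : R.
have D2 : 2 <= D by rewrite (ler_nat R 2).
have Dp : D + 1 != 0 by rewrite gt_eqF // addr_gt0 // (lt_le_trans _ D2).
have Dm : D - 1 != 0 by rewrite gt_eqF // subr_gt0 (lt_le_trans _ D2) // ltr1n.
have D21 : D ^+ 2 - 1 != 0.
  have -> : D ^+ 2 - 1 = (D + 1) * (D - 1) by ring.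
  exact: mulf_neq0.
apply/funext => rho; rewrite /HW_channel /twchan.
have -> : (d%:R ^+ 2 - 1)^-1 = ((D ^+ 2 - 1)^-1)%:C.
  by rewrite fmorphV rmorphB rmorphXn /= rmorph_nat rmorph1.
have -> : d%:R - eta%:C = (D - eta)%:C :> C by rewrite rmorphB /= rmorph_nat.
have -> : d%:R * eta%:C - 1 = (D * eta - 1)%:C :> C.
  by rewrite rmorphB rmorphM /= rmorph_nat rmorph1.
rewrite -scale_scalar_mx scalerDr 2!scalerA -!rmorphM.
congr (_%:C *: _ + _%:C *: _).
  by rewrite /p /q; field; rewrite Dp Dm D21.
by rewrite /p /q; field; rewrite Dp Dm D21.
Qed.

(** Each regime amounts to a choice of [g], [a] and [b]. The weights are given through products
    rather than as quotients, because [1 + g] vanishes when [d = 2] and [g = -1]. *)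
Lemma werner_bound_param (d : nat) (eta g a b : R) : (2 <= d)%N ->
  0 <= a -> 0 <= b -> - (2 / d%:R) <= g -> g <= 0 ->
  a + b - (a - b) / d%:R + `|(a - b) / d%:R| <= 1 ->
  a * (1 + g) = (1 + eta) / 2 -> b * (1 - g) = (1 - eta) / 2 ->
  werner_bound d eta
    ((1 + eta) / 2 * log2 (1 + g) + (1 - eta) / 2 * log2 (1 - g)).
Proof.
move=> d2 a0 b0 g0 g1 ab1 pE qE.
have D2 : 2 <= (d%:R : R) by rewrite (ler_nat R 2).
have D0 : 0 < (d%:R : R) by exact: lt_le_trans D2.
have g01 : 0 <= 1 + g.
  have h : 2 / d%:R <= 1 :> R by rewrite ler_pdivrMr // mul1r.
  by rewrite -lerBlDl sub0r (le_trans _ g0) // lerN2.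
have g02 : 0 < 1 - g by rewrite subr_gt0 (le_lt_trans g1).
have pq1 : a * (1 + g) + b * (1 - g) = 1 by rewrite pE qE; field.
set F := _ + _.
have FE : (a * (1 + g) * ln (1 + g) + b * (1 - g) * ln (1 - g)) / ln 2 = F.
  by rewrite /F -pE -qE /log2 mulrDl !mulrA.
have [U [e [UU fE e1 se]]] := flip_opdiag R d.
have W := wernerE d2 UU fE e1 pE qE.
have bounds n : (0 < n)%N ->
    (F%:E <= EP_rate (werner d eta) n <= (F + n%:R^-1)%:E)%E.
  move=> n0; have n1 : 0 < n%:R :> R by rewrite ltr0n.
  have := EP_werner_bounds d2 a0 b0 pq1 g0 g1 ab1 UU fE e1 se n.
  rewrite -W /EP_rate -[_ / ln 2]mulrA FE => /andP[lo hi].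
  have nE : F%:E = ((n%:R^-1)%:E * (n%:R * F)%:E)%E.
    by rewrite -EFinM mulKf ?gt_eqF.
  have nE' : (F + n%:R^-1)%:E = ((n%:R^-1)%:E * (n%:R * F + 1)%:E)%E.
    by rewrite -EFinM mulrDr mulr1 mulKf ?gt_eqF.
  have ni : (0 <= (n%:R^-1)%:E :> \bar R)%E by rewrite lee_fin invr_ge0 ltW.
  by rewrite nE nE'; apply/andP; split; apply: lee_wpmul2l.
have cv : EP_rate (werner d eta) n @[n --> \oo] --> F%:E.
  (* The additive constant 1 in the upper bound disappears after division by [n]. *)
  apply: (@squeeze_cvge _ _ _ _ (fun=> F%:E) _ (fun n => (F + n%:R^-1)%:E)).
  - by near=> n; apply: bounds; near: n; exact: nbhs_infty_gt.
  - exact: cvg_cst.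
  - apply: cvg_EFin; first exact: nearW.
    rewrite -[X in _ --> X]addr0; apply: cvgD; first exact: cvg_cst.
    apply/(gtr0_cvgV0 _).2; last exact: cvgr_idn.
    by near=> n; rewrite ltr0n; near: n; exact: nbhs_infty_gt.
have limE : EP_inf (werner d eta) = F%:E by exact: cvg_lim.
split; [by apply/cvg_ex; exists F%:E| |exact: limE].
rewrite limE -FE (HW_channelE _ d2) -pE -qE.
apply: (@Q2_twchan R d _ _ a b) => //.
- exact: mulr_ge0.
- by rewrite mulr_ge0 // ltW.
(* If [1 + g = 0] then [p = 0], and the inequality holds whatever the default value of the
   logarithm. *)
- have [h|h] := ltP 0 (1 + g); first by rewrite lnK ?posrE.
  have -> : 1 + g = 0 by apply/eqP; rewrite eq_le h g01.
  by rewrite mulr0 mulr_ge0 ?expR_ge0.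
- by rewrite lnK ?posrE.
Unshelve. all: by end_near. Qed.

(** Here [g = 0], and the comparison operator is the Werner state itself, which is PPT. *)
Lemma werner_bound_pos (d : nat) (eta : R) : (2 <= d)%N ->
  0 <= eta <= 1 -> werner_bound d eta 0.
Proof.
move=> d2 /andP[eta0 eta1].
have D2 : 2 <= (d%:R : R) by rewrite (ler_nat R 2).
have D0 : 0 < (d%:R : R) by exact: lt_le_trans D2.
have := @werner_bound_param d eta 0 ((1 + eta) / 2) ((1 - eta) / 2) d2.
rewrite addr0 subr0 !mulr1 /log2 ln1 mul0r !mulr0 addr0; apply=> //.
- by rewrite divr_ge0 // addr_ge0.
- by rewrite divr_ge0 // subr_ge0.
have -> : (1 + eta) / 2 - (1 - eta) / 2 = eta by field.
have h : 0 <= eta / d%:R by rewrite divr_ge0 // ltW.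
by rewrite ger0_norm // subrK le_eqVlt; apply/orP; left; apply/eqP; field.
Qed.

(** With [g = eta] and [a = b = 1 / 2] the coefficient [(a - b) / d] vanishes, and the trace norm
    condition is an equality. *)
Lemma werner_bound_mid (d : nat) (eta : R) : (2 <= d)%N ->
  - (2 / d%:R) <= eta <= 0 -> werner_bound d eta
    ((1 + eta) / 2 * log2 (1 + eta) + (1 - eta) / 2 * log2 (1 - eta)).
Proof.
move=> d2 /andP[eta0 eta1].
apply: (@werner_bound_param d eta eta 2^-1 2^-1) => //; rewrite ?invr_ge0 //.
- by rewrite subrr mul0r normr0 subr0 addr0 -mulr2n -[_ *+ 2]mulr_natr mulVf ?pnatr_eq0.
- by rewrite mulrC.
- by rewrite mulrC.
Qed.

Lemma werner_bound_neg (d : nat) (eta : R) : (2 <= d)%N ->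
  -1 <= eta -> eta <= - (2 / d%:R) -> werner_bound d eta
    (log2 ((d%:R + 2) / d%:R)
     + (1 + eta) / 2 * log2 ((d%:R - 2) / (d%:R + 2))).
Proof.
move=> d2 etam eta0; set D := d%:R : R.
have D2 : 2 <= D by rewrite (ler_nat R 2).
have D0 : 0 < D by exact: lt_le_trans D2.
have Dp : 0 < D + 2 by rewrite addr_gt0.
have D20 : 0 <= 2 / D by rewrite divr_ge0 // ltW.
have etaD : eta * D <= - 2 by rewrite -ler_pdivlMr // mulNr.
(* For d = 2 one has eta = -1, and D / (D - 2) is the junk value 0. *)
pose a := (1 + eta) / 2 * (D / (D - 2)); pose b := (1 - eta) / 2 * (D / (D + 2)).
have p0 : 0 <= (1 + eta) / 2 by rewrite divr_ge0 //; lra.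
have q0 : 0 <= (1 - eta) / 2 by rewrite divr_ge0 //; lra.
have a0 : 0 <= a by rewrite mulr_ge0 // divr_ge0 ?subr_ge0 // ltW.
have b0 : 0 <= b by rewrite mulr_ge0 // divr_ge0 // ltW.
have aE : a * (1 - 2 / D) = (1 + eta) / 2.
  rewrite /a; have [D2E|D2N] := eqVneq D 2; last first.
    by field; rewrite subr_eq0 D2N gt_eqF.
  have -> : eta = -1 by apply/eqP; rewrite eq_le etam andbT; move: etaD; rewrite D2E; lra.
  by rewrite subrr !mul0r.
have bE : b * (1 + 2 / D) = (1 - eta) / 2.
  by rewrite /b; field; rewrite !gt_eqF.
(* For [D > 2] this is equivalent to [eta <= - 2 / D], the boundary of the regime. *)
have ab : a <= b.
  have [D2E|D2N] := eqVneq D 2.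
    by rewrite /a D2E subrr invr0 !mulr0.
  have Dm : 0 < D - 2 by rewrite subr_gt0 lt_neqAle eq_sym D2N.
  rewrite -subr_ge0 (_ : b - a = D * (- (eta * D) - 2) / ((D + 2) * (D - 2))).
    by rewrite divr_ge0 // ?mulr_ge0 ?(ltW D0) ?(ltW Dm) ?(ltW Dp) //; lra.
  by rewrite /a /b; field; rewrite !gt_eqF.
have -> : log2 ((D + 2) / D) + (1 + eta) / 2 * log2 ((D - 2) / (D + 2)) =
    (1 + eta) / 2 * log2 (1 + - (2 / D)) + (1 - eta) / 2 * log2 (1 - - (2 / D)).
  have -> : 1 - - (2 / D) = (D + 2) / D by field; rewrite gt_eqF.
  have -> : 1 + - (2 / D) = (D - 2) / D by field; rewrite gt_eqF.
  have [D2E|D2N] := eqVneq D 2.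
    have -> : eta = -1 by apply/eqP; rewrite eq_le etam andbT; move: etaD; rewrite D2E; lra.
    by rewrite subrr !mul0r addr0 add0r opprK -mulr2n mulfV ?pnatr_eq0 ?mul1r.
  have Dm : 0 < D - 2 by rewrite subr_gt0 lt_neqAle eq_sym D2N.
  have ln2 : 0 < ln 2 :> R by rewrite ln_gt0 // ltr1n.
  rewrite /log2 !ln_div ?posrE //.
  move: (ln (D - 2)) (ln (D + 2)) (ln D) => u v w.
  by field; rewrite gt_eqF.
apply: (@werner_bound_param d eta (- (2 / D)) a b) => //.
- by rewrite oppr_le0.
(* The absolute value therefore doubles the term [- (a - b) / D], and the condition becomes
   [p + q = 1]. *)
- have h : (a - b) / D <= 0 by rewrite pmulr_lle0 ?invr_gt0 // subr_le0.
  rewrite (ler0_norm h) -/D.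
  have -> : a + b - (a - b) / D - (a - b) / D = a * (1 - 2 / D) + b * (1 + 2 / D).
    by field; rewrite gt_eqF.
  by rewrite aE bE le_eqVlt; apply/orP; left; apply/eqP; field.
- by rewrite opprK.
Qed.

End MainBounds.

Theorem mainTheorem4 (R : realType) (d : nat) (eta : R) :
  (2 <= d)%N -> -1 <= eta <= 1 ->
  [/\ cvg (EP_rate (werner d eta) n @[n --> \oo]),
      (Q2 (@HW_channel R d eta) <= EP_inf (werner d eta))%E &
      [/\ 0 <= eta -> EP_inf (werner d eta) = 0%:E,
          - (2 / d%:R) <= eta <= 0 ->
            EP_inf (werner d eta) =
            ((1 + eta) / 2 * log2 (1 + eta)
             + (1 - eta) / 2 * log2 (1 - eta))%:E &
          eta <= - (2 / d%:R) ->
            EP_inf (werner d eta) =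
            (log2 ((d%:R + 2) / d%:R)
             + (1 + eta) / 2 * log2 ((d%:R - 2) / (d%:R + 2)))%:E]].
Proof.
move=> d2 /andP[etam eta1].
(* Some regime always applies, which gives convergence and the capacity bound; the values are then
   read off regime by regime, common endpoints included. *)
have [F [cv Q _]] : exists F, werner_bound d eta F.
  have [e0|e0] := leP 0 eta.
    by exists 0; apply: werner_bound_pos; rewrite ?e0.
  have [e2|e2] := leP (- (2 / d%:R)) eta.
    by eexists; apply: werner_bound_mid; rewrite ?e2 ?ltW.
  by eexists; apply: werner_bound_neg; rewrite // ltW.
split; [exact: cv|exact: Q|split] => h.
- by case: (@werner_bound_pos R d eta d2) => //; rewrite h.
- by case: (@werner_bound_mid R d eta d2 h).
- by case: (@werner_bound_neg R d eta d2 etam h).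
Qed.
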